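(* Let $a_0,a_1,b_0,b_1,c_0,c_1,d_0,d_1,e_0,e_1,z_0,z_1$ be non-negative integers such that for $i=0,1$: $b_i+c_i=e_i+z_i$, $a_i+b_i=d_i+e_i$, $c_i+d_i=z_i+a_i$; put $a=a_0+a_1$, and similarly $b,c,d,e,z$. Let $\alpha\in\binom{[a]}{a_1}$, $\beta\in\binom{[b]}{b_1}$, $\gamma\in\binom{[c]}{c_1}$, $\delta\in\binom{[d]}{d_1}$, $\epsilon\in\binom{[e]}{e_1}$, $\zeta\in\binom{[z]}{z_1}$. If $\mathrm{sort}(\alpha)=\mathrm{sort}(\gamma)=\mathrm{sort}(\epsilon)$ (and hence also $\mathrm{sort}(\beta)=\mathrm{sort}(\delta)=\mathrm{sort}(\zeta)$), then $$\mathrm{Hex}(\alpha,\beta,\gamma,\delta,\epsilon,\zeta)=\mathrm{Hex}(f(\alpha),g(\beta),f(\gamma),g(\delta),f(\epsilon),g(\zeta))$$ for any pair of bijections $f:\{\alpha,\gamma,\epsilon\}\to\{\alpha,\gamma,\epsilon\}$ and $g:\{\beta,\delta,\zeta\}\to\{\beta,\delta,\zeta\}$ (the labels being regarded as formal symbols). In other words, the triples $\alpha,\gamma,\epsilon$ and $\beta,\delta,\zeta$ can be permuted independently while preserving the number of hexagonal puzzles.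
   Context: Strings: $\binom{[n]}{k}$ denotes the set of binary strings (words in the symbols $0,1$) of length $n$ with exactly $k$ ones; $\mathrm{sort}(\lambda)=0^{n-k}1^k$ for $\lambda\in\binom{[n]}{k}$. Puzzles: work in the triangular lattice in the plane, whose unit edges make angles $0^\circ,60^\circ,120^\circ$ with the $x$-axis. Edge labels are the three symbols $0$, $1$, $10$ (where $10$ is a single symbol). A unit triangle (upward- or downward-pointing) with labeled edges is an allowed piece if its three labels read clockwise are $(0,0,0)$, $(1,1,1)$, or a cyclic rotation of $(1,0,10)$. Given a convex lattice polygon (sides along lattice directions, some sides possibly of length $0$) each of whose sides is labeled by a binary string, one symbol per unit edge, read clockwise around the polygon, a puzzle with this boundary is an assignment of labels to all unit lattice edges in the polygon which agrees with the prescribed labels on the boundary and for which every unit triangle in the polygon is an allowed piece. $\mathrm{Hex}(\alpha,\beta,\gamma,\delta,\epsilon,\zeta)$ is the number of puzzles on the convex hexagon (all angles $120^\circ$, some sides possibly of length $0$) whose sides, in clockwise order SW, NW, North, NE, SE, South, are labeled respectively $\alpha,\beta,\gamma,\delta,\epsilon,\zeta$, each read clockwise; the side lengths are the lengths of the strings. *)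

(* Defs.v *)
From mathcomp Require Import all_boot all_fingroup.

Set Implicit Arguments.
Unset Strict Implicit.
Unset Printing Implicit Defensive.

(* Binary strings are [seq bool], with [false] for 0 and [true] for 1. *)

Definition binstr (n k : nat) : {pred seq bool} :=
  [pred s | (size s == n) && (count_mem true s == k)].

Definition sort01 (s : seq bool) : seq bool :=
  nseq (count_mem false s) false ++ nseq (count_mem true s) true.

(* Edge labels: the symbols 0 and 1 are [Some false] and [Some true]; the
   single symbol 10 is [None]. *)
Definition label := option bool.
Definition L0 : label := Some false.
Definition L1 : label := Some true.
Definition L10 : label := None.

(* Labels of a unit triangle, read clockwise; the last three triples are the
   cyclic rotations of (1, 0, 10). *)
Definition allowed (u v w : label) : bool :=
  (u, v, w) \in [:: (L0, L0, L0); (L1, L1, L1);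
                    (L1, L0, L10); (L0, L10, L1); (L10, L1, L0)].

(* The pair (x, y) is the lattice point x * (1, 0) + y * (1/2, sqrt 3 / 2), so
   (1, 0), (0, 1) and (-1, 1) are the unit steps at 0, 60 and 120 degrees. *)
Definition point := (nat * nat)%type.
Definition edge := (point * point)%type.
Definition edge0 (x y : nat) : edge := ((x, y), (x.+1, y)).
Definition edge60 (x y : nat) : edge := ((x, y), (x, y.+1)).
Definition edge120 (x y : nat) : edge := ((x.+1, y), (x, y.+1)).

Section Hexagon.

(* Lengths of the sides SW, NW, North, NE. Clockwise from the left end of the
   South side, the vertices are
     (a, 0), (0, a), (0, a + b), (c, a + b), (c + d, a + b - d), (c + d, 0);
   the lengths of SE and South are then a + b - d and c + d - a. *)
Variables a b c d : nat.

Definition in_hex (p : point) : bool :=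
  [&& p.1 <= c + d, p.2 <= a + b, a <= p.1 + p.2 & p.1 + p.2 <= a + b + c].

Definition box : seq point :=
  [seq (x, y) | x <- iota 0 (c + d).+1, y <- iota 0 (a + b).+1].

Definition hex_edges : seq edge :=
  [seq e <- flatten [seq [:: edge0 p.1 p.2; edge60 p.1 p.2; edge120 p.1 p.2]
                    | p <- box]
  | in_hex e.1 && in_hex e.2].

Definition labeling := {ffun seq_sub hex_edges -> label}.

(* The default value is irrelevant: [label_at] is only used on edges of the
   hexagon. *)
Definition label_at (P : labeling) (e : edge) : label :=
  if insub e is Some u then P u else L10.

(* The upward triangle with vertices (x, y), (x+1, y), (x, y+1). *)
Definition up_ok (P : labeling) (p : point) : bool :=
  let: (x, y) := p in
  [&& in_hex (x, y), in_hex (x.+1, y) & in_hex (x, y.+1)] ==>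
  allowed (label_at P (edge60 x y)) (label_at P (edge120 x y))
          (label_at P (edge0 x y)).

(* The downward triangle with vertices (x, y+1), (x+1, y+1), (x+1, y). *)
Definition down_ok (P : labeling) (p : point) : bool :=
  let: (x, y) := p in
  [&& in_hex (x, y.+1), in_hex (x.+1, y.+1) & in_hex (x.+1, y)] ==>
  allowed (label_at P (edge0 x y.+1)) (label_at P (edge60 x.+1 y))
          (label_at P (edge120 x y)).

Definition triangles_ok (P : labeling) : bool :=
  all (fun p => up_ok P p && down_ok P p) box.

(* [side i] is the i-th unit edge of the side, read clockwise. *)
Definition side_ok (P : labeling) (side : nat -> edge) (s : seq bool) : bool :=
  [forall i : 'I_(size s), label_at P (side i) == Some (nth false s i)].

End Hexagon.

(* Meaningful when the side lengths close up, i.e.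
   a + b = d + e and c + d = z + a, which also gives b + c = e + z. *)
Definition Hex (alpha beta gamma delta epsilon zeta : seq bool) : nat :=
  let a := size alpha in let b := size beta in let c := size gamma in
  let d := size delta in let e := size epsilon in
  #|[set P : labeling a b c d |
     [&& triangles_ok P,
         side_ok P (fun i => edge120 (a - i.+1) i) alpha,
         side_ok P (fun i => edge60 0 (a + i)) beta,
         side_ok P (fun i => edge0 i (a + b)) gamma,
         side_ok P (fun i => edge120 (c + i) (a + b - i.+1)) delta,
         side_ok P (fun i => edge60 (c + d) (e - i.+1)) epsilon &
         side_ok P (fun i => edge0 (c + d - i.+1) 0) zeta]]|.

(* Permutations of formal symbols are permutations of the indices 0, 1, 2; the
   strings carried by distinct symbols may coincide. *)
Definition i0 : 'I_3 := @Ordinal 3 0 isT.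
Definition i1 : 'I_3 := @Ordinal 3 1 isT.
Definition i2 : 'I_3 := @Ordinal 3 2 isT.

Definition triple (u v w : seq bool) (i : 'I_3) : seq bool :=
  nth [::] [:: u; v; w] i.

(* Main.v *)
Require Import Defs.
From mathcomp Require Import all_boot all_fingroup all_algebra.
From mathcomp Require Import zify ring.

(* Glue three corner triangles to the sides alpha, gamma, epsilon of the hexagon.
   A corner triangle one of whose sides is the sorted string [id] merely copies
   its second side to the third, so Hex(alpha, ..., zeta) is the number of
   triangular puzzles with sides (alpha beta gamma), (id delta id),
   (epsilon zeta id). Exchange the first two sides of this triangle and cut the
   corners off again: now gamma and epsilon occur only as two sides of the same
   corner triangle, and exchanging them there exchanges them in the hexagon.
   Rotations by 60 degrees give all other permutations.

   Triangular puzzles are commutative by a Yang-Baxter argument: a line carrying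
   a state and a parameter t can be pushed across every unit triangle. Pushing it
   across a whole triangle shows that the Pieri operator H(t) applied to one side
   can be applied to the next side instead. The coefficients of H(t) generate all
   strings from the sorted one, for which the puzzles are explicit. *)

Set Implicit Arguments.
Unset Strict Implicit.
Unset Printing Implicit Defensive.

Import GRing.Theory Num.Theory.

Notation bin := (map (@Some bool)).

(** * Labelings and their symmetries *)

Definition edge_of (k x y : nat) : edge :=
  match k with 0 => edge0 x y | 1 => edge60 x y | _ => edge120 x y end.

Definition edge_dir (e : edge) : nat :=
  if e.1.1 < e.2.1 then 0 else if e.1.1 == e.2.1 then 1 else 2.

Section Interface.

Variables a b c d : nat.

Notation in_hex := (in_hex a b c d).

Definition edge_in (k x y : nat) : bool :=
  in_hex (edge_of k x y).1 && in_hex (edge_of k x y).2.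

Lemma mem_hex_edges k x y :
  (edge_of k x y \in hex_edges a b c d) = edge_in k x y.
Proof.
rewrite /hex_edges mem_filter -/(edge_in k x y).
rewrite andbC; case Hin: (edge_in k x y); rewrite ?andbF ?andbT //.
apply/flattenP; exists [:: edge0 x y; edge60 x y; edge120 x y]; last first.
  by case: k {Hin} => [|[|k]] /=; rewrite !inE eqxx ?orbT.
apply/mapP; exists (x, y) => //.
apply/allpairsP; exists (x, y); split; rewrite ?mem_iota //;
  move: Hin; rewrite /edge_in /Defs.in_hex; case: k => [|[|k]] /=; lia.
Qed.

Lemma hex_edgesP e :
  e \in hex_edges a b c d -> exists k x y, k < 3 /\ e = edge_of k x y.
Proof.
rewrite mem_filter => /andP[_ /flattenP[s /mapP[[x y] _ ->]]] /=.
rewrite !inE => /or3P[] /eqP ->;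
  [by exists 0, x, y | by exists 1, x, y | by exists 2, x, y].
Qed.

Notation labeling := (labeling a b c d).

Definition lab (P : labeling) (k x y : nat) : label := label_at P (edge_of k x y).

Lemma lab_ext (P Q : labeling) :
  (forall k x y, k < 3 -> edge_in k x y -> lab P k x y = lab Q k x y) -> P = Q.
Proof.
move=> H; apply/ffunP=> u.
have [k [x [y [k3 Hu]]]] := hex_edgesP (valP u).
have Hin : edge_in k x y by rewrite -mem_hex_edges -Hu; exact: valP.
by have := H _ _ _ k3 Hin; rewrite /lab /label_at -Hu valK.
Qed.

(** The direction and base point of an edge are recovered from its end points. Edges at 120 degrees
    are stored from right to left, hence the minimum of the abscissae. *)
Definition mk_labeling (f : nat -> nat -> nat -> label) : labeling :=
  [ffun u => f (edge_dir (val u)) (minn (val u).1.1 (val u).2.1) (val u).1.2].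

Lemma lab_mk f k x y :
  k < 3 -> edge_in k x y -> lab (mk_labeling f) k x y = f k x y.
Proof.
rewrite -mem_hex_edges => k3 Hin; rewrite /lab /label_at insubT ffunE /=.
case: k k3 {Hin} => [|[|[|k]]] //= _; rewrite /edge_dir /=.
- by rewrite ltnSn (minn_idPl _).
- by rewrite ltnn eqxx minnn.
- by rewrite (minn_idPr _) // ltnNge leqnSn /= gtn_eqF.
Qed.

(** Stated for a function on all coordinates, so that it can be checked before [mk_labeling]
    restricts the function to the hexagon. *)
Definition triangles (f : nat -> nat -> nat -> label) : Prop :=
  (forall x y, in_hex (x, y) -> in_hex (x.+1, y) -> in_hex (x, y.+1) ->
     allowed (f 1 x y) (f 2 x y) (f 0 x y)) /\
  (forall x y, in_hex (x, y.+1) -> in_hex (x.+1, y.+1) -> in_hex (x.+1, y) ->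
     allowed (f 0 x y.+1) (f 1 x.+1 y) (f 2 x y)).

Lemma triangles_okP (P : labeling) : reflect (triangles (lab P)) (triangles_ok P).
Proof.
apply: (iffP allP) => [H | [H1 H2] [x y] _].
  have bx x y : x <= c + d -> y <= a + b -> (x, y) \in box a b c d.
    by move=> ? ?; apply/allpairsP; exists (x, y); rewrite !mem_iota /=; split=> //; lia.
  split=> x y h1 h2 h3.
    have /H/andP[/implyP] : (x, y) \in box a b c d.
      by apply: bx; move: h1; rewrite /Defs.in_hex /=; lia.
    by rewrite h1 h2 h3 => /(_ isT).
  have /H/andP[_ /implyP] : (x, y) \in box a b c d.
    by apply: bx; move: h1 h3; rewrite /Defs.in_hex /=; lia.
  by rewrite h1 h2 h3 => /(_ isT).
by rewrite /up_ok /down_ok; apply/andP; split; apply/implyP => /and3P[? ? ?];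
  [apply: H1 | apply: H2].
Qed.

End Interface.

Definition side_is (s : seq label) (f : nat -> label) : Prop :=
  forall i, i < size s -> f i = nth L10 s i.

Definition sides (a b c d : nat) (al be ga de ep ze : seq label)
    (f : nat -> nat -> nat -> label) : Prop :=
  [/\ side_is al (fun i => f 2 (a - i.+1) i),
      side_is be (fun i => f 1 0 (a + i)) &
      side_is ga (fun i => f 0 i (a + b))] /\
  [/\ side_is de (fun i => f 2 (c + i) (a + b - i.+1)),
      side_is ep (fun i => f 1 (c + d) (size ep - i.+1)) &
      side_is ze (fun i => f 0 (c + d - i.+1) 0)].

Definition side_isb (s : seq label) (f : nat -> label) : bool :=
  [forall i : 'I_(size s), f i == nth L10 s i].

Lemma side_isP s f : reflect (side_is s f) (side_isb s f).
Proof.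
apply: (iffP forallP) => [H i Hi|H i]; last by rewrite H.
exact: eqP (H (Ordinal Hi)).
Qed.

Definition puzzles (a b c d : nat) (al be ga de ep ze : seq label) :
    {set labeling a b c d} :=
  [set P | [&& triangles_ok P,
     side_isb al (fun i => lab P 2 (a - i.+1) i),
     side_isb be (fun i => lab P 1 0 (a + i)),
     side_isb ga (fun i => lab P 0 i (a + b)),
     side_isb de (fun i => lab P 2 (c + i) (a + b - i.+1)),
     side_isb ep (fun i => lab P 1 (c + d) (size ep - i.+1)) &
     side_isb ze (fun i => lab P 0 (c + d - i.+1) 0)]].

(** Sides may carry the label 10 here, because the string read along a cut inside a puzzle need not
    be binary. *)
Definition LHex al be ga de ep ze : nat :=
  #|puzzles (size al) (size be) (size ga) (size de) al be ga de ep ze|.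

Lemma puzzlesP a b c d al be ga de ep ze P :
  reflect (triangles a b c d (lab P) /\ sides a b c d al be ga de ep ze (lab P))
          (P \in puzzles a b c d al be ga de ep ze).
Proof.
rewrite inE; apply: (iffP and5P).
  move=> [/triangles_okP ? /side_isP ? /side_isP ? /side_isP ?
           /and3P[/side_isP ? /side_isP ? /side_isP ?]].
  by split; last by split; split.
move=> [? [[? ? ?] [? ? ?]]]; split; try exact/side_isP; first exact/triangles_okP.
by apply/and3P; split; apply/side_isP.
Qed.

Lemma Hex_LHex al be ga de ep ze :
  Hex al be ga de ep ze =
  LHex (map Some al) (map Some be) (map Some ga) (map Some de) (map Some ep) (map Some ze).
Proof.
have E s (f : nat -> label) :
    [forall i : 'I_(size s), f i == Some (nth false s i)] = side_isb (map Some s) f.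
  apply/forallP/side_isP => [H i|H i]; last by rewrite H ?(nth_map false) ?size_map.
  by rewrite size_map => Hi; rewrite (nth_map false) // (eqP (H (Ordinal Hi))).
rewrite /Hex /LHex /puzzles !size_map; congr #|pred_of_set _|.
apply/setP=> P; rewrite !inE /side_ok -!E.
by do ![congr (_ && _)]; apply: eq_forallb.
Qed.

Definition closed6 (al be ga de ep ze : seq label) : Prop :=
  size al + size be = size de + size ep /\ size ga + size de = size ze + size al.

Lemma mk_puzzle a b c d al be ga de ep ze f :
  [/\ size al = a, size be = b, size ga = c & size de = d] ->
  closed6 al be ga de ep ze ->
  triangles a b c d f -> sides a b c d al be ga de ep ze f ->
  mk_labeling _ _ _ _ f \in puzzles a b c d al be ga de ep ze.
Proof.
move=> [E1 E2 E3 E4] [cl1 cl2] [T1 T2] [[s1 s2 s3] [s4 s5 s6]]; apply/puzzlesP; split.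
  split=> x y h1 h2 h3.
    by rewrite !lab_mk //; [apply: T1 | | | ]; rewrite /edge_in /= ?h1 ?h2 ?h3.
  by rewrite !lab_mk //; [apply: T2 | | | ]; rewrite /edge_in /= ?h1 ?h2 ?h3.
split; split=> i Hi; rewrite lab_mk ?s1 ?s2 ?s3 ?s4 ?s5 ?s6 //;
  rewrite /edge_in /in_hex /=; lia.
Qed.

Lemma allowed_rot u v w : allowed u v w = allowed v w u.
Proof. by case: u v w => [[]|] [[]|] [[]|]. Qed.

Lemma lab_ext3 a b c d (P Q : labeling a b c d) :
  (forall x y, edge_in a b c d 0 x y -> lab P 0 x y = lab Q 0 x y) ->
  (forall x y, edge_in a b c d 1 x y -> lab P 1 x y = lab Q 1 x y) ->
  (forall x y, edge_in a b c d 2 x y -> lab P 2 x y = lab Q 2 x y) -> P = Q.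
Proof.
by move=> H0 H1 H2; apply: lab_ext => - [|[|[|k]]] x y // _; [apply: H0|apply: H1|apply: H2].
Qed.

(* The labels of the puzzle turned by 60 degrees counterclockwise, in terms of
   the labels [f] of the original one; [b] and [n] are the original [b] and
   [a + b]. *)
Definition rot60 (b n : nat) (f : nat -> nat -> nat -> label) (k x y : nat) : label :=
  match k with
  | 0 => f 2 (x + y - b) (n - x).-1
  | 1 => f 0 (x + y - b) (n - x)
  | _ => f 1 ((x + y).+1 - b) (n - x).-1
  end.

(** Turning puzzles by 60 degrees is injective, since every edge of the original hexagon is read by
    some edge of the turned one. *)
Lemma LHex_rot_le al be ga de ep ze :
  closed6 al be ga de ep ze ->
  LHex al be ga de ep ze <= LHex be ga de ep ze al.
Proof.
move=> cl; have [cl1 cl2] := cl.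
pose F (P : labeling (size al) (size be) (size ga) (size de)) :
    labeling (size be) (size ga) (size de) (size ep) :=
  mk_labeling _ _ _ _ (rot60 (size be) (size al + size be) (lab P)).
pose m := size al + size be.
have LF R k x y : k < 3 -> edge_in (size be) (size ga) (size de) (size ep) k x y ->
    lab (F R) k x y = rot60 (size be) m (lab R) k x y.
  by move=> k3 kin; rewrite lab_mk.
have Finj : injective F.
  move=> P Q E.
  have E' k x y : k < 3 -> edge_in (size be) (size ga) (size de) (size ep) k x y ->
     rot60 (size be) m (lab P) k x y = rot60 (size be) m (lab Q) k x y.
    by move=> k3 kin; rewrite -!LF // E.
  rewrite /m in E'.
  (* In each direction the coordinates passed to [E'] are those of the turned edge at which [rot60]
     reads the given edge. *)
  apply: lab_ext3 => x y; rewrite /edge_in /in_hex /= => xy.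
  - have := E' 1 (size al + size be - y) (x + y - size al) isT.
    rewrite /rot60 /edge_in /in_hex /=.
    have -> : size al + size be - y + (x + y - size al) - size be = x by lia.
    have -> : size al + size be - (size al + size be - y) = y by lia.
    by apply; lia.
  - have := E' 2 (size al + size be - y).-1 (x + y - size al) isT.
    rewrite /rot60 /edge_in /in_hex /=.
    have -> : ((size al + size be - y).-1 + (x + y - size al)).+1 - size be = x by lia.
    have -> : (size al + size be - (size al + size be - y).-1).-1 = y by lia.
    by apply; lia.
  - have := E' 0 (size al + size be - y).-1 (x + y.+1 - size al) isT.
    rewrite /rot60 /edge_in /in_hex /=.
    have -> : (size al + size be - y).-1 + (x + y.+1 - size al) - size be = x by lia.
    have -> : (size al + size be - (size al + size be - y).-1).-1 = y by lia.
    by apply; lia.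
rewrite /LHex -(card_imset (mem (puzzles _ _ _ _ al be ga de ep ze)) Finj).
apply/subset_leq_card/subsetP => Q /imsetP[P].
move=> /puzzlesP[[T1 T2] [[s1 s2 s3] [s4 s5 s6]]] ->{Q}.
apply: mk_puzzle => //; first by split; lia.
- split=> x y; rewrite /in_hex /rot60 /= => h1 h2 h3.
  + have := T2 (x + y - size be) (m - x).-1; rewrite /in_hex /m /=.
    have -> : (size al + size be - x).-1.+1 = size al + size be - x by lia.
    have -> : (x + y - size be).+1 = (x + y).+1 - size be by lia.
    by apply; lia.
  + rewrite -allowed_rot; have := T1 ((x + y).+1 - size be) (m - x).-1.
    rewrite /in_hex /m /=.
    have -> : x + y.+1 - size be = (x + y).+1 - size be by lia.
    have -> : x.+1 + y - size be = (x + y).+1 - size be by lia.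
    have -> : size al + size be - x.+1 = (size al + size be - x).-1 by lia.
    by apply; lia.
- split; split=> i Hi /=.
  + rewrite -s2 //; congr (lab P); lia.
  + rewrite -s3 //; congr (lab P); lia.
  + rewrite -s4 //; congr (lab P); lia.
  + rewrite -s5 //; congr (lab P); lia.
  + rewrite -s6 //; congr (lab P); lia.
  + rewrite -s1 //; congr (lab P); lia.
Qed.

(** Six successive rotations lead back to the first hexagon, so all six inequalities are
    equalities. *)
Lemma LHex_rot al be ga de ep ze :
  closed6 al be ga de ep ze ->
  LHex al be ga de ep ze = LHex be ga de ep ze al.
Proof.
move=> cl; apply/eqP; rewrite eqn_leq LHex_rot_le //=.
have rot u v w x y z : closed6 u v w x y z -> closed6 v w x y z u.
  by move=> [? ?]; split; lia.
have [c1 c2 c3 c4 c5] :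
  [/\ closed6 be ga de ep ze al, closed6 ga de ep ze al be, closed6 de ep ze al be ga,
      closed6 ep ze al be ga de & closed6 ze al be ga de ep] by do ![split]; move: cl => [? ?]; lia.
do 4!(apply: leq_trans (LHex_rot_le _) _ => //).
exact: LHex_rot_le.
Qed.

Lemma nth_cat_size T (x : T) s1 s2 i : nth x (s1 ++ s2) (size s1 + i) = nth x s2 i.
Proof. by rewrite nth_cat ltnNge leq_addr /= addKn. Qed.

Lemma nth_catl T (x : T) s1 s2 i : i < size s1 -> nth x (s1 ++ s2) i = nth x s1 i.
Proof. by rewrite nth_cat => ->. Qed.

(** * Cutting a hexagon along a lattice line at 60 degrees *)

Section Cut.

Variables (al1 al2 be ga1 ga2 de1 de2 ep ze1 ze2 : seq label) (n : nat).

Notation a := (size (al2 ++ al1)).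
Notation c := (size (ga1 ++ ga2)).
Notation d := (size (de1 ++ de2)).
Notation big := (puzzles a (size be) c d (al2 ++ al1) be (ga1 ++ ga2) (de1 ++ de2) ep (ze2 ++ ze1)).
Notation a1 := (size al1).
Notation a2 := (size al2).
Notation b := (size be).
Notation c1 := (size ga1).
Notation c2 := (size ga2).
Notation d1 := (size de1).
Notation d2 := (size de2).

Hypothesis cl : closed6 (al2 ++ al1) be (ga1 ++ ga2) (de1 ++ de2) ep (ze2 ++ ze1).
(** The cut is the line [x = j], with [n] unit edges. By [cut_top] its upper end lies on the North
    side ([d1 = 0]) or on the NE side ([c2 = 0]); by [cut_low] its lower end lies on the SW or on
    the South side. Clockwise reading meets the right part of the lower sides first, hence the
    orders [al2 ++ al1] and [ze2 ++ ze1]. *)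
Hypothesis cut_bottom : a1 + size ze1 = c1 + d1.
Hypothesis cut_column : n + d1 = a1 + b.
Hypothesis cut_top : d1 = 0 \/ c2 = 0.
Hypothesis cut_low : size ze1 = 0 \/ a2 = 0.

Let j := c1 + d1.

Let bigE : [/\ size (al2 ++ al1) = a2 + a1, size (ga1 ++ ga2) = c1 + c2,
  size (de1 ++ de2) = d1 + d2 & size (ze2 ++ ze1) = size ze2 + size ze1].
Proof. by rewrite !size_cat. Qed.

(** The SW side of the left part has length [a1] only, so its coordinates sit lower by [a2]. *)
Lemma in_hex_left x y :
  in_hex a1 b c1 d1 (x, y) =
  in_hex (size (al2 ++ al1)) b (size (ga1 ++ ga2)) (size (de1 ++ de2)) (x, y + a2) && (x <= j).
Proof. rewrite /in_hex /j /=; move: cl bigE => [? ?] [? ? ? ?]; lia. Qed.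

Lemma in_hex_right x y :
  in_hex a2 n c2 d2 (x, y) =
  in_hex (size (al2 ++ al1)) b (size (ga1 ++ ga2)) (size (de1 ++ de2)) (x + j, y).
Proof. rewrite /in_hex /j /=; move: cl bigE => [? ?] [? ? ? ?]; lia. Qed.

Let column (P : labeling a b c d) : n.-tuple label :=
  [tuple lab P 1 j (a2 + i) | i < n].

Let left_part (P : labeling a b c d) : labeling a1 b c1 d1 :=
  mk_labeling _ _ _ _ (fun k x y => lab P k x (y + a2)).
Let right_part (P : labeling a b c d) : labeling a2 n c2 d2 :=
  mk_labeling _ _ _ _ (fun k x y => lab P k (x + j) y).

Let column_nth P i : i < n -> nth L10 (column P) i = lab P 1 j (a2 + i).
Proof. by move=> Hi; rewrite -(tnth_nth _ _ (Ordinal Hi)) tnth_mktuple. Qed.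

Let left_puzzle P :
  P \in big -> left_part P \in puzzles a1 b c1 d1 al1 be ga1 de1 (rev (column P)) ze1.
Proof.
move=> /puzzlesP[[T1 T2] [[s1 s2 s3] [s4 s5 s6]]].
have [cl1 cl2] := cl; have [E1 E2 E3 E4] := bigE.
have := @column_nth P; move: (size_tuple (column P)).
move: (tval (column P)) => s Es sE; apply: mk_puzzle => //.
- by split; rewrite ?size_rev ?Es; lia.
- split=> x y; rewrite !in_hex_left => /andP[h1 _] /andP[h2 _] /andP[h3 _].
    by apply: T1; rewrite // -addSn.
  by rewrite addSn; apply: T2; rewrite // -addSn.
- split; split=> i Hi /=.
  + have := s1 (a2 + i); rewrite nth_cat_size => <-; last by lia.
    congr (lab P); lia.
  + rewrite -s2 //; congr (lab P); lia.
  + have := s3 i; rewrite nth_catl // => <-; last by lia.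
    congr (lab P); lia.
  + have := s4 i; rewrite nth_catl // => <-; last by lia.
    congr (lab P); lia.
  + rewrite size_rev Es in Hi *.
    rewrite nth_rev Es // sE; last by lia.
    congr (lab P); lia.
  + have := s6 (size ze2 + i); rewrite nth_cat_size => <-; last by lia.
    congr (lab P); lia.
Qed.

Let right_puzzle P :
  P \in big -> right_part P \in puzzles a2 n c2 d2 al2 (column P) ga2 de2 ep ze2.
Proof.
move=> /puzzlesP[[T1 T2] [[s1 s2 s3] [s4 s5 s6]]].
have [cl1 cl2] := cl; have [E1 E2 E3 E4] := bigE.
have := @column_nth P; move: (size_tuple (column P)).
move: (tval (column P)) => s Es sE; apply: mk_puzzle => //.
- by split; lia.
- split=> x y; rewrite !in_hex_right => h1 h2 h3.
    by apply: T1; rewrite // -addSn.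
  by rewrite addSn; apply: T2; rewrite // -addSn.
- split; split=> i Hi /=.
  + have := s1 i; rewrite nth_catl // => <-; last by lia.
    congr (lab P); lia.
  + rewrite Es in Hi; rewrite sE //; congr (lab P); lia.
  + have := s3 (c1 + i); rewrite nth_cat_size => <-; last by lia.
    congr (lab P); lia.
  + have := s4 (d1 + i); rewrite nth_cat_size => <-; last by lia.
    congr (lab P); lia.
  + rewrite -s5 //; congr (lab P); lia.
  + have := s6 i; rewrite nth_catl // => <-; last by lia.
    congr (lab P); lia.
Qed.

Section Glue.

Variables (s : n.-tuple label) (Q1 : labeling a1 b c1 d1) (Q2 : labeling a2 n c2 d2).
Hypothesis Q1P : Q1 \in puzzles a1 b c1 d1 al1 be ga1 de1 (rev s) ze1.
Hypothesis Q2P : Q2 \in puzzles a2 n c2 d2 al2 s ga2 de2 ep ze2.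

(** Edges on the cut are read from the right puzzle; that the left puzzle agrees there is the
    content of [glued_left]. *)
Let glued k x y := if x < j then lab Q1 k x (y - a2) else lab Q2 k (x - j) y.

Let glued_left k x y :
  k < 3 -> edge_in a1 b c1 d1 k x y -> glued k x (y + a2) = lab Q1 k x y.
Proof.
have [cl1 cl2] := cl; have [E1 E2 E3 E4] := bigE.
rewrite /glued addnK; case: (ltnP x j) => // jx k3.
case: k k3 => [|[|[|k]]] // _; rewrite /edge_in /in_hex /= => xy; try lia.
have -> : x = j by rewrite /j in jx *; lia.
rewrite subnn; move: Q1P Q2P.
move=> /puzzlesP[_ [_ [_ s5 _]]] /puzzlesP[_ [[_ s2 _] _]].
have := s2 y; rewrite addnC size_tuple => ->; last by lia.
(* The SE side is read downwards, so the edge at height [y] of the cut is its entry [n - y.+1]. *)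
have := s5 (n - y.+1); rewrite size_rev size_tuple nth_rev size_tuple; last by lia.
rewrite (_ : n - (n - y.+1).+1 = y); last by lia.
by move=> -> //; lia.
Qed.

Let glued_right k x y : glued k (x + j) y = lab Q2 k x y.
Proof. by rewrite /glued ltnNge leq_addl /= addnK. Qed.

Let glued_puzzle : mk_labeling a b c d glued \in big.
Proof.
move: Q1P Q2P => /puzzlesP[[T1 T2] [[s1 s2 s3] [s4 s5 s6]]].
move=> /puzzlesP[[U1 U2] [[r1 r2 r3] [r4 r5 r6]]].
have [cl1 cl2] := cl; have [E1 E2 E3 E4] := bigE.
have low x y : x <= j -> in_hex a b c d (x, y) -> exists y', y = y' + a2.
  by rewrite /in_hex /j /= => ? ?; exists (y - a2); lia.
apply: mk_puzzle => //.
- split=> x y h1 h2 h3; case: (ltnP x j) => xj.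
  + have [y' Ey] := low _ _ (ltnW xj) h1; subst y.
    rewrite -addSn in h3.
    have k1 : in_hex a1 b c1 d1 (x, y') by rewrite in_hex_left h1 ltnW.
    have k2 : in_hex a1 b c1 d1 (x.+1, y') by rewrite in_hex_left h2.
    have k3 : in_hex a1 b c1 d1 (x, y'.+1) by rewrite in_hex_left h3 ltnW.
    by rewrite !glued_left ?T1 // /edge_in /= ?k1 ?k2 ?k3.
  + rewrite -(subnK xj) -?addSn in h1 h2 h3 *; rewrite !glued_right.
    by apply: U1; rewrite in_hex_right.
  + have [y' Ey] := low _ _ xj h3; subst y.
    rewrite -?addSn in h1 h2 h3 *.
    have k1 : in_hex a1 b c1 d1 (x, y'.+1) by rewrite in_hex_left h1 ltnW.
    have k2 : in_hex a1 b c1 d1 (x.+1, y'.+1) by rewrite in_hex_left h2.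
    have k3 : in_hex a1 b c1 d1 (x.+1, y') by rewrite in_hex_left h3.
    by rewrite !glued_left ?T2 // /edge_in /= ?k1 ?k2 ?k3.
  + rewrite -(subnK xj) -?addSn in h1 h2 h3 *; rewrite !glued_right.
    by apply: U2; rewrite in_hex_right.
have L k x y u v : x = u -> y = v + a2 -> k < 3 -> edge_in a1 b c1 d1 k u v ->
    glued k x y = lab Q1 k u v by move=> -> ->; exact: glued_left.
have R k x y u v : x = u + j -> y = v -> glued k x y = lab Q2 k u v.
  by move=> -> ->; exact: glued_right.
split; split=> i Hi.
- case: (ltnP i a2) => ia.
    rewrite nth_catl // -r1 //; apply: R => //; rewrite /j; lia.
  rewrite -(subnKC ia) nth_cat_size -s1; last by lia.
  apply: L => //; first lia; first lia; rewrite /edge_in /in_hex /=; lia.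
- rewrite -s2 //; apply: L => //; first lia; rewrite /edge_in /in_hex /=; lia.
- case: (ltnP i c1) => ia.
    rewrite nth_catl // -s3 //; apply: L => //; first lia.
    rewrite /edge_in /in_hex /=; lia.
  rewrite -(subnKC ia) nth_cat_size -r3; last by lia.
  apply: R; rewrite /j; lia.
- case: (ltnP i d1) => ia.
    rewrite nth_catl // -s4 //; apply: L => //; first lia; first lia.
    rewrite /edge_in /in_hex /=; lia.
  rewrite -(subnKC ia) nth_cat_size -r4; last by lia.
  apply: R; rewrite /j; lia.
- rewrite -r5 //; apply: R; rewrite /j; lia.
- case: (ltnP i (size ze2)) => ia.
    rewrite nth_catl // -r6 //; apply: R; rewrite /j; lia.
  rewrite -(subnKC ia) nth_cat_size -s6; last by lia.
  apply: L => //; first lia; first lia.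
  rewrite /edge_in /in_hex /=; lia.
Qed.

Lemma glue : exists2 P, P \in [set P in big | column P == s] & (Q1, Q2) = (left_part P, right_part P).
Proof.
have [cl1 cl2] := cl; have [E1 E2 E3 E4] := bigE.
exists (mk_labeling a b c d glued).
  rewrite inE glued_puzzle /=; apply/eqP/val_inj/(@eq_from_nth _ L10).
    by rewrite !size_tuple.
  move=> i; rewrite size_tuple => Hi; rewrite column_nth //.
  move: Q2P => /puzzlesP[_ [[_ s2 _] _]]; rewrite -s2 ?size_tuple //.
  rewrite lab_mk //; last by rewrite /edge_in /in_hex /j /=; lia.
  by rewrite -[in LHS](add0n j) glued_right.
congr pair; apply: lab_ext => k x y k3 xy; rewrite lab_mk //.
  rewrite lab_mk ?glued_left //.
  move: xy; rewrite /edge_in; case: k k3 => [|[|[|k]]] // _ /=; rewrite !in_hex_left ?addSn;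
   by move=> /andP[/andP[-> _] /andP[-> _]].
rewrite lab_mk ?glued_right //.
by move: xy; rewrite /edge_in; case: k k3 => [|[|[|k]]] // _ /=; rewrite !in_hex_right ?addSn.
Qed.

End Glue.

(** Classify the puzzles by the string [s] on the cut: each class is in bijection with pairs of
    puzzles on the two parts. Read upwards, [s] is clockwise for the right part and counterclockwise
    for the left part, hence [rev s]. *)
Lemma LHex_cut :
  LHex (al2 ++ al1) be (ga1 ++ ga2) (de1 ++ de2) ep (ze2 ++ ze1) =
  \sum_(s : n.-tuple label)
    LHex al1 be ga1 de1 (rev s) ze1 * LHex al2 s ga2 de2 ep ze2.
Proof.
have [cl1 cl2] := cl; have [E1 E2 E3 E4] := bigE.
rewrite /LHex -sum1_card (partition_big column predT) //=.
apply: eq_bigr => s _; rewrite sum1dep_card size_tuple -cardsX.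
rewrite -(@card_in_imset _ _ (fun P => (left_part P, right_part P)) [set P in big | column P == s]).
  apply/eq_card=> -[Q1 Q2]; rewrite in_setX; apply/imsetP/andP.
    move=> [P]; rewrite inE => /andP[PB /eqP <-] [-> ->].
    by split; [exact: left_puzzle | exact: right_puzzle].
  by move=> [H1 H2]; have [P PS E] := glue H1 H2; exists P.
move=> P Q _ _ [EL ER]; apply: lab_ext => k x y k3 xy.
case: (ltnP x j) => xj.
  have y2 : a2 <= y.
    by move: xy; case: k k3 => [|[|[|k]]] // _; rewrite /edge_in /in_hex /=; rewrite /j in xj; lia.
  have xy1 : edge_in a1 b c1 d1 k x (y - a2).
    move: xy; rewrite /edge_in; case: k k3 => [|[|[|k]]] // _ /=;
      rewrite !in_hex_left ?addSn ?subnK // => /andP[-> ->]; rewrite /= ?xj ?(ltnW xj) //.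
  by have := congr1 (fun R => lab R k x (y - a2)) EL; rewrite !lab_mk // subnK.
have xy2 : edge_in a2 n c2 d2 k (x - j) y.
  by move: xy; rewrite /edge_in; case: k k3 => [|[|[|k]]] // _ /=;
    rewrite !in_hex_right ?addSn ?subnK.
by have := congr1 (fun R => lab R k (x - j) y) ER; rewrite !lab_mk // subnK.
Qed.

End Cut.

(** * Triangles cut into strips *)

Lemma big_label (R : Type) (idx : R) (op : Monoid.com_law idx) (F : label -> R) :
  \big[op/idx]_(m : label) F m = op (F L0) (op (F L1) (F L10)).
Proof.
rewrite (bigD1 L0) //= (bigD1 L1) //= (bigD1 L10) //= big1 ?Monoid.mulm1 //.
by case=> [[]|].
Qed.

Section TupleSums.

Variables (R : Type) (idx : R) (op : Monoid.com_law idx) (T : finType).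

Lemma big_tuple0 (F : seq T -> R) : \big[op/idx]_(s : 0.-tuple T) F s = F [::].
Proof. by rewrite (big_pred1 [tuple]) // => s; rewrite (tuple0 s) /= eqxx. Qed.

Lemma big_tupleS n (F : seq T -> R) :
  \big[op/idx]_(s : n.+1.-tuple T) F s =
  \big[op/idx]_(x : T) \big[op/idx]_(s : n.-tuple T) F (x :: s).
Proof.
rewrite pair_big /= (reindex (fun p : T * n.-tuple T => cons_tuple p.1 p.2)) //=.
exists (fun s : n.+1.-tuple T => (thead s, behead_tuple s)) => [[x s] _|s _] /=.
  by congr pair; apply: val_inj.
by case/tupleP: s => x s; apply: val_inj.
Qed.

Lemma big_tuple1 (F : seq T -> R) :
  \big[op/idx]_(s : 1.-tuple T) F s = \big[op/idx]_(x : T) F [:: x].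
Proof. by rewrite big_tupleS; apply: eq_bigr => x _; rewrite (big_tuple0 (fun s => F (x :: s))). Qed.

End TupleSums.

(** Puzzles on a strip of width one between two lines at 60 degrees: [x] and [y] are the left and
    right sides read upwards, [h] is the bottom edge and [d] the slanted top edge. A recursive call
    removes the lowest rhombus, with diagonal [u] and top [h']. *)
Fixpoint strip (h : label) (x : seq label) (d : label) (y : seq label) : nat :=
  match y with
  | [::] => if x is [:: x0] then allowed x0 d h else 0
  | y0 :: y' => if x is x0 :: x' then
        \sum_(u : label) \sum_(h' : label)
           (allowed x0 u h * allowed h' y0 u) * strip h' x' d y'
      else 0
  end.

(** The strips are peeled off from the left, so [hs] lists the South side from left to right,
    against the clockwise order. *)
Fixpoint tri (x ds hs : seq label) : nat :=
  match ds, hs with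
  | [::], [::] => x == [::]
  | d :: ds', h :: hs' =>
      \sum_(y : (size x).-1.-tuple label) strip h x d y * tri y ds' hs'
  | _, _ => 0
  end.

Lemma LHex_unit x d h : LHex [::] [:: x] [::] [:: d] [::] [:: h] = allowed x d h.
Proof.
have edges k u v : k < 3 -> edge_in 0 1 0 1 k u v -> u = 0 /\ v = 0.
  by case: k => [|[|[|k]]] // _; rewrite /edge_in /in_hex /=; lia.
pose f (k u v : nat) := nth L10 [:: h; x; d] k.
have sol P : P \in puzzles 0 1 0 1 [::] [:: x] [::] [:: d] [::] [:: h] ->
    allowed x d h /\ P = mk_labeling _ _ _ _ f.
  move=> /puzzlesP[[T _] [[_ s2 _] [s4 _ s6]]].
  have {}s2 : lab P 1 0 0 = x by have := s2 0 isT.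
  have {}s4 : lab P 2 0 0 = d by have := s4 0 isT.
  have {}s6 : lab P 0 0 0 = h by have := s6 0 isT.
  split; first by have := T 0 0 isT isT isT; rewrite s2 s4 s6.
  apply: lab_ext => k u v k3 uv; rewrite lab_mk //; have [-> ->] := edges _ _ _ k3 uv.
  by case: k k3 {uv} => [|[|[|k]]].
rewrite /LHex /=; case A: (allowed x d h); last first.
  by apply: eq_card0 => P; apply/negP => /sol[]; rewrite A.
rewrite (_ : puzzles _ _ _ _ _ _ _ _ _ _ = [set mk_labeling _ _ _ _ f]) ?cards1 //.
apply/setP=> P; rewrite in_set1; apply/idP/eqP => [/sol[]|->] //.
apply: mk_puzzle => //.
  split=> u v; rewrite /in_hex /f /=; first by [].
  by move=> ? ? ?; exfalso; lia.
by split; split=> [] [|i].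
Qed.

Lemma LHex_empty : LHex [::] [::] [::] [::] [::] [::] = 1.
Proof.
pose f (k u v : nat) := L10.
rewrite /LHex (_ : puzzles _ _ _ _ _ _ _ _ _ _ = [set mk_labeling _ _ _ _ f]) ?cards1 //.
apply/setP=> P; rewrite in_set1; apply/idP/eqP => [_|->].
  by apply: lab_ext => [] [|[|[|k]]] u v // _; rewrite /edge_in /in_hex /=; lia.
by apply: mk_puzzle.
Qed.

Opaque LHex.

Lemma LHex_down p q r : LHex [:: p] [::] [:: q] [::] [:: r] [::] = allowed p q r.
Proof. by rewrite LHex_rot // LHex_unit -allowed_rot. Qed.

Lemma LHex_rhombus h x0 h' y0 :
  LHex [:: y0] [:: h] [::] [:: x0] [:: h'] [::] =
  \sum_(u : label) allowed x0 u h * allowed h' y0 u.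
Proof.
(* The rotations bring the diagonal of the rhombus to 60 degrees, the direction of cuts. *)
rewrite 4?LHex_rot //.
have := @LHex_cut [:: h'] [::] [::] [:: y0] [::] [::] [:: h] [::] [::] [:: x0] 1.
move=> /= -> //; try by [left | right].
rewrite (big_tuple1 _ (fun s => LHex _ _ _ _ (rev s) _ * LHex _ s _ _ _ _)).
by apply: eq_bigr => u _; rewrite LHex_down LHex_unit mulnC allowed_rot allowed_rot.
Qed.

Lemma LHex_strip h x d y :
  size x = (size y).+1 -> LHex [::] x [::] [:: d] (rev y) [:: h] = strip h x d y.
Proof.
elim: y x h => [|y0 y IH] [|x0 x] h //= [sx]; first by case: x sx => // _; rewrite LHex_unit.
(* In the turned strip a line at 60 degrees cuts off the lowest rhombus. *)
rewrite -LHex_rot; last by split; rewrite /= ?size_rev /= ?sx; lia.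
rewrite -LHex_rot; last by split; rewrite /= ?size_rev /= ?sx; lia.
have := @LHex_cut [:: y0] (rev y) [:: h] [::] [::] [:: x0] x [::] [::] [:: d] 1.
rewrite rev_cons -cats1 /= => ->; try by [right | left].
- rewrite (big_tuple1 _ (fun s => LHex _ _ _ _ (rev s) _ * LHex _ s _ _ _ _)).
  rewrite [RHS]exchange_big /=.
  apply: eq_bigr => h' _; rewrite LHex_rhombus big_distrl /=; apply: eq_bigr => u _.
  rewrite -IH //; congr (_ * _).
  rewrite LHex_rot; last by split; rewrite /= ?size_rev; lia.
  by rewrite LHex_rot; last by split; rewrite /= ?size_rev; lia.
- by split; rewrite /= ?size_cat ?size_rev /=; lia.
- by [].
- by [].
Qed.

Lemma LHex_tri x ds zs :
  size x = size ds -> size ds = size zs -> LHex [::] x [::] ds [::] zs = tri x ds (rev zs).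
Proof.
elim: ds x zs => [|d ds IH] x zs.
  by case: x => // _; case: zs => // _; rewrite LHex_empty.
case: x => [//|x0 x]; case/lastP: zs => [//|zs h] [sx]; rewrite size_rcons => -[sz].
rewrite rev_rcons /=.
have := @LHex_cut [::] [::] (x0 :: x) [::] [::] [:: d] ds [::] [:: h] zs (size x).
rewrite /= cats1 => ->; try by [right | rewrite addn1].
  apply: eq_bigr => s _; rewrite LHex_strip ?size_tuple // IH ?size_tuple //.
by split; rewrite /= ?size_rcons; lia.
Qed.

(** * Pushing a line across a triangle *)

Local Open Scope ring_scope.

Lemma sum_label (R : nmodType) (F : label -> R) :
  \sum_(m : label) F m = F L0 + F L1 + F L10.
Proof. by rewrite big_label /= addrA. Qed.

(* A line in state [s] crosses an edge of direction 60, 120 or 0 degrees whose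
   label is [X] on its left and [x] on its right, and leaves in state [s']. The
   weights are a degenerate R-matrix of type A2, solving the two equations
   [sweep_up] and [sweep_down] by which the line is pushed across a unit
   triangle; between states 0 and 1, [w60] transfers Pieri's rule. *)
Section Weights.

Variables (R : comNzRingType) (t : R).

Definition w60 (s X x s' : label) : R :=
  match s, X, x, s' with
  | Some false, Some false, Some false, Some false => t
  | Some false, Some false, Some true, Some true => t
  | Some false, Some false, None, None => t ^+ 2
  | Some false, Some true, Some true, Some false => t
  | Some false, None, None, Some false => t
  | Some true, Some false, Some false, Some true => t ^+ 2
  | Some true, Some true, Some false, Some false => t ^+ 2
  | None, Some false, Some false, None => t ^+ 2
  | None, Some true, Some true, None => t
  | None, None, Some false, Some false => t
  | _, _, _, _ => 0
  end.

Definition w120 (s X x s' : label) : R :=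
  match s, X, x, s' with
  | Some false, Some false, Some false, Some false => 1
  | Some false, Some false, Some true, None => t
  | Some false, Some true, Some true, Some false => 1
  | Some false, None, Some true, Some true => 1
  | Some false, None, None, Some false => 1
  | Some true, Some false, Some false, Some true => 1
  | Some true, Some false, None, None => t ^+ 2
  | Some true, Some true, None, Some false => t
  | Some true, None, None, Some true => t
  | None, Some false, Some false, None => t
  | None, Some true, Some false, Some false => 1
  | None, None, Some false, Some true => 1
  | _, _, _, _ => 0
  end.

Definition w0 (s X x s' : label) : R :=
  match s, X, x, s' with
  | Some false, Some false, Some false, Some false => t
  | Some false, Some true, Some true, Some false => t
  | Some false, Some true, None, None => t
  | Some true, Some true, Some false, None => t ^+ 2
  | Some true, Some true, Some true, Some true => t
  | None, Some false, Some false, None => t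
  | None, Some false, Some true, Some true => 1
  | None, Some true, Some true, None => -1
  | None, None, Some true, Some false => 1
  | None, None, None, None => 1
  | _, _, _, _ => 0
  end.

(** The line moves from the left edge of an upward triangle to its bottom and right edges. Capital
    letters are the labels to the left of the line. *)
Lemma sweep_up s s' X h d :
  \sum_(x : label) w60 s X x s' * (allowed x d h)%:R =
  \sum_(H : label) \sum_(D : label) \sum_(m : label)
     (allowed X D H)%:R * (w0 s H h m * w120 m D d s').
Proof.
rewrite sum_label; under [RHS]eq_bigr => H _ do under eq_bigr => D _ do rewrite sum_label.
under [RHS]eq_bigr => H _ do rewrite sum_label.
rewrite sum_label.
(* A polynomial identity in [t] for each of the 243 choices of five labels. *)
by case: s s' X h d => [[]|] [[]|] [[]|] [[]|] [[]|]; rewrite /allowed /=; ring.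
Qed.

(** The line moves from the left and top edges of a downward triangle to its right edge. *)
Lemma sweep_down s s' D H y :
  \sum_(d : label) \sum_(h : label) \sum_(m : label)
     (w120 s D d m * w0 m H h s') * (allowed h y d)%:R =
  \sum_(Y : label) (allowed H Y D)%:R * w60 s Y y s'.
Proof.
rewrite [RHS]sum_label; under eq_bigr => d _ do under eq_bigr => h _ do rewrite sum_label.
under eq_bigr => d _ do rewrite sum_label.
rewrite sum_label.
by case: s s' D H y => [[]|] [[]|] [[]|] [[]|] [[]|]; rewrite /allowed /=; ring.
Qed.

End Weights.

Lemma sum_exchange4 (R : comNzRingType) (I J M N : finType)
    (a : I -> M -> R) (l : M -> J -> R) (r : I -> N -> R) (q : N -> J -> R) :
  \sum_i \sum_j (\sum_m a i m * l m j) * (\sum_n r i n * q n j) =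
  \sum_m \sum_n (\sum_i a i m * r i n) * (\sum_j l m j * q n j).
Proof.
transitivity (\sum_i \sum_m \sum_n (a i m * r i n) * (\sum_j l m j * q n j)).
  apply: eq_bigr => i _; transitivity (\sum_j \sum_m \sum_n a i m * r i n * (l m j * q n j)).
    apply: eq_bigr => j _; rewrite big_distrl; apply: eq_bigr => m _ /=.
    by rewrite big_distrr; apply: eq_bigr => n _ /=; ring.
  rewrite exchange_big; apply: eq_bigr => m _; rewrite exchange_big.
  by apply: eq_bigr => n _; rewrite big_distrr.
rewrite exchange_big; apply: eq_bigr => m _; rewrite exchange_big.
by apply: eq_bigr => n _; rewrite big_distrl.
Qed.

Lemma sum_exchange31 (R : nmodType) (I J K L : finType) (F : I -> J -> K -> L -> R) :
  \sum_i \sum_j \sum_k \sum_l F i j k l = \sum_l \sum_i \sum_j \sum_k F i j k l.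
Proof.
rewrite [RHS]exchange_big; apply: eq_bigr => i _.
rewrite [RHS]exchange_big; apply: eq_bigr => j _; exact: exchange_big.
Qed.

Lemma sum_assoc3 (R : comNzRingType) (I J K : finType) (S : R)
    (a : I -> R) (b : I -> J -> R) (l : J -> K -> R) (v : K -> R) :
  \sum_k a k * (S * \sum_m (\sum_n b k n * l n m) * v m) =
  S * \sum_n (\sum_k a k * b k n) * \sum_m l n m * v m.
Proof.
transitivity (\sum_k \sum_n \sum_m S * (a k * b k n * (l n m * v m))).
  apply: eq_bigr => k _; rewrite exchange_big 2!big_distrr; apply: eq_bigr => m _ /=.
  by rewrite big_distrl 2!big_distrr; apply: eq_bigr => n _ /=; ring.
rewrite exchange_big big_distrr; apply: eq_bigr => n _ /=.
rewrite big_distrl big_distrr; apply: eq_bigr => k _ /=.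
by rewrite 2!big_distrr.
Qed.

Lemma triS x d ds h hs n :
  size x = n.+1 ->
  tri x (d :: ds) (h :: hs) = (\sum_(y : n.-tuple label) strip h x d y * tri y ds hs)%N.
Proof. by move=> sx /=; rewrite sx. Qed.

Section Sweep.

Variables (R : comNzRingType) (t : R).

Notation w60 := (w60 t).
Notation w120 := (w120 t).
Notation w0 := (w0 t).

Fixpoint line (W : label -> label -> label -> label -> R) (s : label)
    (X x : seq label) (s' : label) : R :=
  match X, x with
  | [::], [::] => (s == s')%:R
  | a :: X', b :: x' => \sum_(m : label) W s a b m * line W m X' x' s'
  | _, _ => 0
  end.

(** After the sweep the line climbs along the NE side, whose labels are listed downwards; so the
    last entry is crossed first. *)
Fixpoint rline (W : label -> label -> label -> label -> R) (s : label)
    (X x : seq label) (s' : label) : R :=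
  match X, x with
  | [::], [::] => (s == s')%:R
  | a :: X', b :: x' => \sum_(m : label) rline W s X' x' m * W m a b s'
  | _, _ => 0
  end.

Definition rhombus (x h y h' : label) : R :=
  \sum_(u : label) (allowed x u h)%:R * (allowed h' y u)%:R.

Lemma stripS h x0 x d y0 y :
  (strip h (x0 :: x) d (y0 :: y))%:R =
  \sum_(h' : label) rhombus x0 h y0 h' * (strip h' x d y)%:R :> R.
Proof.
rewrite /= natr_sum; under eq_bigr => u _ do rewrite natr_sum.
rewrite exchange_big; apply: eq_bigr => h' _; rewrite /rhombus big_distrl /=.
by apply: eq_bigr => u _; rewrite !natrM.
Qed.

Lemma sum_delta (F : label -> R) s : \sum_m F m * (m == s)%:R = F s.
Proof.
rewrite (bigD1 s) //= eqxx mulr1 big1 ?addr0 // => m /negbTE ->; exact: mulr0.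
Qed.

Lemma sum_deltal (F : label -> R) s : \sum_m (s == m)%:R * F m = F s.
Proof. by rewrite -[RHS]sum_delta; apply: eq_bigr => m _; rewrite mulrC eq_sym. Qed.

(** The line crosses the left and top edges before the push, and the bottom and right edges after
    it: [sweep_up] in the lower triangle is followed by [sweep_down] in the upper one. *)
Lemma sweep_rhombus s X h y H' n :
  \sum_m \sum_h' (\sum_x w60 s X x m * rhombus x h y h') * w0 m H' h' n =
  \sum_H \sum_Y rhombus X H Y H' * \sum_k w0 s H h k * w60 k Y y n.
Proof.
transitivity (\sum_m \sum_h' \sum_u (\sum_x w60 s X x m * (allowed x u h)%:R)
               * ((allowed h' y u)%:R * w0 m H' h' n)).
  apply: eq_bigr => m _; apply: eq_bigr => h' _; rewrite big_distrl /=.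
  transitivity (\sum_x \sum_u w60 s X x m * (allowed x u h)%:R * ((allowed h' y u)%:R * w0 m H' h' n)).
    apply: eq_bigr => x _; rewrite /rhombus big_distrr big_distrl /=.
    by apply: eq_bigr => u _; ring.
  by rewrite exchange_big; apply: eq_bigr => u _; rewrite big_distrl.
transitivity (\sum_H \sum_U \sum_k (allowed X U H)%:R * w0 s H h k *
   \sum_u \sum_h' \sum_m (w120 k U u m * w0 m H' h' n) * (allowed h' y u)%:R).
  transitivity (\sum_m \sum_h' \sum_u \sum_H \sum_U \sum_k
     (allowed X U H)%:R * w0 s H h k * ((w120 k U u m * w0 m H' h' n) * (allowed h' y u)%:R)).
    apply: eq_bigr => m _; apply: eq_bigr => h' _; apply: eq_bigr => u _.
    rewrite sweep_up big_distrl; apply: eq_bigr => H _ /=.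
    rewrite big_distrl; apply: eq_bigr => U _ /=.
    by rewrite big_distrl; apply: eq_bigr => k _ /=; ring.
  rewrite sum_exchange31; apply: eq_bigr => H _.
  rewrite sum_exchange31; apply: eq_bigr => U _.
  rewrite sum_exchange31; apply: eq_bigr => k _.
  under eq_bigr => m _ do rewrite exchange_big.
  rewrite exchange_big big_distrr; apply: eq_bigr => u _ /=.
  rewrite exchange_big big_distrr; apply: eq_bigr => h' _ /=.
  by rewrite big_distrr.
under eq_bigr => H _ do under eq_bigr => U _ do under eq_bigr => k _ do rewrite sweep_down.
apply: eq_bigr => H _.
transitivity (\sum_U \sum_k \sum_Y (allowed X U H)%:R * (allowed H' Y U)%:R * (w0 s H h k * w60 k Y y n)).
  apply: eq_bigr => U _; apply: eq_bigr => k _; rewrite big_distrr.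
  by apply: eq_bigr => Y _ /=; ring.
under eq_bigr => U _ do rewrite exchange_big.
rewrite exchange_big; apply: eq_bigr => Y _; rewrite /rhombus big_distrl /=.
by apply: eq_bigr => U _; rewrite big_distrr.
Qed.

(** Induction from the bottom: [sweep_rhombus] moves the line across the lowest rhombus, and
    [sweep_up] across the single triangle at the top. The pair [p] holds the new labels of the top
    edge and of the right side. *)
Lemma sweep_strip s s' X h d y :
  size X = (size y).+1 ->
  \sum_(x : (size X).-tuple label) line w60 s X x s' * (strip h x d y)%:R =
  \sum_H \sum_n w0 s H h n *
    \sum_(p : label * (size y).-tuple label) (strip H X p.1 p.2)%:R *
       \sum_m line w60 n p.2 y m * w120 m p.1 d s'.
Proof.
elim: y X s h => [|y0 y IH] [|X0 X] s h //= [sX].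
  case: X sX => // _; rewrite (big_tuple1 _ (fun x => line w60 s [:: X0] x s' * (strip h x d [::])%:R)) /=.
  under eq_bigr => x _ do rewrite sum_delta.
  rewrite sweep_up; apply: eq_bigr => H _; rewrite exchange_big /=; apply: eq_bigr => n _.
  rewrite -(pair_bigA _ (fun D (Y : 0.-tuple label) => (strip H [:: X0] D Y)%:R *
    \sum_m line w60 n Y [::] m * w120 m D d s')) /= big_distrr /=.
  apply: eq_bigr => D _; rewrite (big_tuple0 _ (fun Y => (strip H [:: X0] D Y)%:R *
    \sum_m line w60 n Y [::] m * w120 m D d s')) /= sum_deltal; ring.
rewrite (big_tupleS _ _ (fun x => line w60 s (X0 :: X) x s' * (strip h x d (y0 :: y))%:R)).
under eq_bigr => x0 _ do under eq_bigr => x _ do rewrite stripS.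
rewrite sum_exchange4.
pose Q n H := \sum_(p : label * (size y).-tuple label)
  (strip H X p.1 p.2)%:R * \sum_m line w60 n p.2 y m * w120 m p.1 d s'.
transitivity (\sum_H \sum_n (\sum_m \sum_h'
   (\sum_x w60 s X0 x m * rhombus x h y0 h') * w0 m H h' n) * Q n H).
  transitivity (\sum_m \sum_h' \sum_H \sum_n
     (\sum_x w60 s X0 x m * rhombus x h y0 h') * w0 m H h' n * Q n H).
    apply: eq_bigr => m _; apply: eq_bigr => h' _; rewrite IH // big_distrr /=.
    apply: eq_bigr => H _; rewrite big_distrr /=; apply: eq_bigr => n _; exact: mulrA.
  under eq_bigr => m _ do rewrite exchange_big.
  rewrite exchange_big; apply: eq_bigr => H _ /=.
  under eq_bigr => m _ do rewrite exchange_big.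
  rewrite exchange_big; apply: eq_bigr => n _ /=; rewrite big_distrl; apply: eq_bigr => m _ /=.
  by rewrite big_distrl.
transitivity (\sum_H \sum_n (\sum_H' \sum_Y rhombus X0 H' Y H *
   \sum_k w0 s H' h k * w60 k Y y0 n) * Q n H).
  by apply: eq_bigr => H _; apply: eq_bigr => n _; rewrite sweep_rhombus.
transitivity (\sum_H' \sum_H \sum_n
   (\sum_Y rhombus X0 H' Y H * \sum_k w0 s H' h k * w60 k Y y0 n) * Q n H).
  rewrite [RHS]exchange_big; apply: eq_bigr => H _; rewrite [RHS]exchange_big.
  by apply: eq_bigr => n _; rewrite big_distrl.
apply: eq_bigr => H' _.
rewrite -(sum_exchange4 (fun Y H => rhombus X0 H' Y H) (fun H (p : label * (size y).-tuple label) => (strip H X p.1 p.2)%:R)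
   (fun Y n => \sum_k w0 s H' h k * w60 k Y y0 n)
   (fun n p => \sum_m line w60 n p.2 y m * w120 m p.1 d s')).
rewrite -[LHS](eq_bigr _ (fun Y _ => pair_bigA _ (fun D (Y' : (size y).-tuple label) =>
  (\sum_H rhombus X0 H' Y H * (strip H X D Y')%:R) *
  \sum_n (\sum_k w0 s H' h k * w60 k Y y0 n) *
    \sum_m line w60 n Y' y m * w120 m D d s'))).
transitivity (\sum_k \sum_D \sum_Y \sum_(Y' : (size y).-tuple label) w0 s H' h k *
    ((\sum_H rhombus X0 H' Y H * (strip H X D Y')%:R) *
  \sum_m (\sum_n w60 k Y y0 n * line w60 n Y' y m) * w120 m D d s')).
  rewrite exchange_big [RHS]exchange_big; apply: eq_bigr => D _.
  rewrite [RHS]exchange_big; apply: eq_bigr => Y _.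
  rewrite [RHS]exchange_big; apply: eq_bigr => Y' _.
  by rewrite sum_assoc3.
apply: eq_bigr => k _.
rewrite -(pair_bigA _ (fun D (Y : (size (y0 :: y)).-tuple label) => (strip H' (X0 :: X) D Y)%:R *
    \sum_m line w60 k Y (y0 :: y) m * w120 m D d s')) big_distrr /=.
apply: eq_bigr => D _.
rewrite (big_tupleS _ _ (fun Y => (strip H' (X0 :: X) D Y)%:R *
    \sum_m line w60 k Y (y0 :: y) m * w120 m D d s')) big_distrr /=.
apply: eq_bigr => Y _; rewrite big_distrr; apply: eq_bigr => Y' _ /=.
by rewrite -stripS.
Qed.

(** A line in state 0 crosses a horizontal edge with a binary right label only by keeping its state
    and the label, with weight [t]. *)
Lemma sweep_strip0 s' X (h : bool) d y :
  size X = (size y).+1 ->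
  \sum_(x : (size X).-tuple label) line w60 L0 X x s' * (strip (Some h) x d y)%:R =
  t * \sum_(p : label * (size y).-tuple label) (strip (Some h) X p.1 p.2)%:R *
       \sum_m line w60 L0 p.2 y m * w120 m p.1 d s'.
Proof.
move=> sX; rewrite sweep_strip // (bigD1 (Some h)) //= [X in _ + X]big1 ?addr0.
  rewrite (bigD1 L0) //= [X in _ + X]big1 ?addr0; first by case: h.
  by case: h => [] [[]|] //= _; rewrite mul0r.
by case: h => [] [[]|] //= _; apply: big1 => [] [[]|] _; rewrite mul0r.
Qed.

(** The strips are crossed from left to right. Each contributes a factor [t] from its bottom edge
    and one more crossing of the NE side. *)
Lemma sweep_tri s' X ds (hs : seq bool) :
  size X = size ds -> size ds = size hs ->
  \sum_(x : (size X).-tuple label) line w60 L0 X x s' * (tri x ds (bin hs))%:R =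
  t ^+ size X *
  \sum_(Ds : (size ds).-tuple label) (tri X Ds (bin hs))%:R * rline w120 L0 Ds ds s'.
Proof.
elim: ds X hs s' => [|d ds IH] X hs s' sX shs.
  case: X hs sX shs => [|//] [|//] _ _; rewrite expr0 mul1r.
  rewrite (big_tuple0 _ (fun x => line w60 L0 [::] x s' * (tri x [::] [::])%:R)).
  by rewrite (big_tuple0 _ (fun D => (tri [::] D [::])%:R * rline w120 L0 D [::] s')) /= mulrC.
case: hs shs => [//|h hs] [shs].
transitivity (\sum_(y : (size ds).-tuple label)
   (\sum_(x : (size X).-tuple label) line w60 L0 X x s' * (strip (Some h) x d y)%:R)
     * (tri y ds (bin hs))%:R).
  transitivity (\sum_(x : (size X).-tuple label) \sum_(y : (size ds).-tuple label)
     line w60 L0 X x s' * (strip (Some h) x d y)%:R * (tri y ds (bin hs))%:R).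
    apply: eq_bigr => x _; rewrite (@triS _ _ _ _ _ (size ds)) ?size_tuple //.
    by rewrite natr_sum big_distrr; apply: eq_bigr => y _ /=; rewrite natrM mulrA.
  by rewrite exchange_big; apply: eq_bigr => y _; rewrite big_distrl.
transitivity (t * \sum_D \sum_(Y : (size ds).-tuple label) (strip (Some h) X D Y)%:R *
   \sum_m w120 m D d s' *
    \sum_(y : (size Y).-tuple label) line w60 L0 Y y m * (tri y ds (bin hs))%:R).
  transitivity (\sum_(y : (size ds).-tuple label) t *
    \sum_D \sum_(Y : (size ds).-tuple label) (strip (Some h) X D Y)%:R *
     \sum_m w120 m D d s' * (line w60 L0 Y y m * (tri y ds (bin hs))%:R)).
    apply: eq_bigr => y _; rewrite sweep_strip0 ?size_tuple // -mulrA; congr (_ * _).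
    rewrite -(pair_bigA _ (fun D (Y : (size ds).-tuple label) =>
      (strip (Some h) X D Y)%:R * \sum_m line w60 L0 Y y m * w120 m D d s')) big_distrl /=.
    apply: eq_bigr => D _; rewrite big_distrl; apply: eq_bigr => Y _ /=.
    rewrite -mulrA; congr (_ * _); rewrite big_distrl; apply: eq_bigr => m _ /=; ring.
  rewrite -big_distrr /=; congr (_ * _); rewrite exchange_big; apply: eq_bigr => D _ /=.
  rewrite exchange_big; apply: eq_bigr => Y _ /=; rewrite -big_distrr /=; congr (_ * _).
  rewrite exchange_big; apply: eq_bigr => m _ /=; rewrite -big_distrr /=; congr (_ * _).
  by rewrite size_tuple.
rewrite [in RHS](_ : size X = (size ds).+1) // exprS -mulrA; congr (_ * _).
rewrite (big_tupleS _ _ (fun Ds => (tri X Ds (bin (h :: hs)))%:R * rline w120 L0 Ds (d :: ds) s')).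
rewrite big_distrr; apply: eq_bigr => D _ /=.
transitivity (\sum_(Y : (size ds).-tuple label) (strip (Some h) X D Y)%:R * \sum_m w120 m D d s' *
  (t ^+ size ds * \sum_(Ds : (size ds).-tuple label) (tri Y Ds (bin hs))%:R * rline w120 L0 Ds ds m)).
  apply: eq_bigr => Y _; congr (_ * _); apply: eq_bigr => m _; congr (_ * _).
  by rewrite IH ?size_tuple.
transitivity (\sum_(Y : (size ds).-tuple label) \sum_(Ds : (size ds).-tuple label)
   t ^+ size ds * ((strip (Some h) X D Y)%:R * (tri Y Ds (bin hs))%:R *
     \sum_m rline w120 L0 Ds ds m * w120 m D d s')).
  apply: eq_bigr => Y _.
  transitivity (\sum_m \sum_(Ds : (size ds).-tuple label) t ^+ size ds *
     ((strip (Some h) X D Y)%:R * (tri Y Ds (bin hs))%:R * (rline w120 L0 Ds ds m * w120 m D d s'))).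
    rewrite big_distrr; apply: eq_bigr => m _ /=; rewrite !big_distrr; apply: eq_bigr => Ds _ /=.
    ring.
  rewrite exchange_big; apply: eq_bigr => Ds _ /=; rewrite -big_distrr; congr (_ * _).
  by rewrite -big_distrr.
rewrite exchange_big big_distrr; apply: eq_bigr => Ds _ /=.
rewrite -big_distrr; congr (_ * _).
have -> : (size X).-1 = size ds by rewrite sX.
by rewrite natr_sum big_distrl; apply: eq_bigr => Y _ /=; rewrite natrM.
Qed.

(** The coefficient of [x] in H(t) applied to [X]: each one of [X] may move towards the head,
    without reaching the old position of the preceding one, and [t] counts the steps. This is the
    addition of a horizontal strip to a partition whose rows count the zeros behind each one.
    [carry] means that a one has been placed in [x] but not yet met in [X]. *)
Fixpoint pieri (carry : bool) (X x : seq bool) : R :=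
  match X, x with
  | [::], [::] => (~~ carry)%:R
  | a :: X', b :: x' =>
      match carry, a, b with
      | false, false, true => pieri true X' x'
      | false, _, _ => (a == b)%:R * pieri false X' x'
      | true, _, false => t * pieri (~~ a) X' x'
      | true, _, _ => 0
      end
  | _, _ => 0
  end.

(** With binary labels on its left, a line in state 10 can never leave that state. *)
Lemma line_None X x : line w60 L10 (bin X) x L0 = 0.
Proof.
elim: X x => [|a X IH] [|b x] //=; apply: big1 => m _.
by case: a b m => [] [[]|] [[]|] /=; rewrite ?IH ?(mulr0, mul0r).
Qed.

(** States 0 and 1 are the two values of [carry]; every crossing has weight [t], with a further [t]
    for every step of a moving one. *)
Lemma line_pieri (carry : bool) X x :
  size X = size x ->
  line w60 (Some carry) (bin X) (bin x) L0 = t ^+ size X * pieri carry X x.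
Proof.
elim: X x carry => [|a X IH] [|b x] carry //=; first by case: carry; rewrite mul1r.
move=> [sx]; rewrite (exprS t (size X)) sum_label line_None mulr0 addr0.
by case: carry a b => [] [] [] /=; rewrite /L0 /L1 ?IH //=; ring.
Qed.

Lemma line_nonbin (s : bool) X x :
  None \in x -> line w60 (Some s) (bin X) x L0 = 0.
Proof.
elim: X x s => [|a X IH] [|b x] s //=; rewrite in_cons sum_label line_None mulr0 addr0.
by case: b => [b|] /=; [move=> Hx; rewrite /L0 /L1 !IH // !mulr0 addr0 |
  case: s a => [] []; rewrite /= !mul0r addr0].
Qed.

(** Read from the other end, the same moves are made with state 10 as the carry, and now without the
    common factor [t]. *)
Lemma rline_pieri (carry : bool) X x :
  size X = size x ->
  rline w120 L0 (bin x) (bin X) (if carry then None else L0) = pieri carry X x.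
Proof.
elim: X x carry => [|a X IH] [|b x] carry //=; first by case: carry.
move=> [sx]; have I1 := IH x true sx; have I0 := IH x false sx.
by rewrite sum_label /L10; case: carry a b => [] [] [] /=; rewrite ?I1 ?I0 /=; ring.
Qed.

(** A nonzero crossing from 10 on the left to a binary label on the right ends in state 1, which the
    line cannot leave while its right labels are binary. *)
Lemma rline_nonbin (carry : bool) (X : seq bool) x :
  None \in x -> rline w120 L0 x (bin X) (if carry then None else L0) = 0.
Proof.
elim: X x carry => [|a X IH] [|b x] carry //=; rewrite in_cons sum_label.
case: b => [b|] /=; last by move=> _; case: carry a => [] []; rewrite /= !mulr0 !addr0.
move=> Hx; have I1 := IH x true Hx; have I0 := IH x false Hx.
by case: carry a b => [] [] [] /=; rewrite ?I1 ?I0 /=; ring.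
Qed.

End Sweep.

Lemma sum_bin (R : comNzRingType) n (F : seq label -> R) :
  (forall s, None \in s -> F s = 0) ->
  \sum_(s : n.-tuple label) F s = \sum_(s : n.-tuple bool) F (bin s).
Proof.
elim: n F => [|n IH] F F0.
  by rewrite (big_tuple0 _ F) (big_tuple0 _ (fun s => F (bin s))).
rewrite (big_tupleS _ _ F) (big_tupleS _ _ (fun s => F (bin s))) sum_label [X in _ + X]big1.
  rewrite addr0 big_bool addrC; congr (_ + _); apply: (IH (fun s => F (_ :: s))) => s sN;
  by apply: F0; rewrite in_cons sN orbT.
by move=> s _; apply: F0; rewrite in_cons eqxx.
Qed.

(** This is [sweep_tri] for a line that leaves in state 0: only binary strings contribute, and the
    common factor [t ^+ n] cancels in a domain. *)
Lemma tri_pieri (R : idomainType) (t : R) n (X ds hs : n.-tuple bool) :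
  t != 0 ->
  \sum_(x : n.-tuple bool) pieri t false X x * (tri (bin x) (bin ds) (bin hs))%:R =
  \sum_(D : n.-tuple bool) pieri t false ds D * (tri (bin X) (bin D) (bin hs))%:R.
Proof.
move=> t0; have := @sweep_tri _ t L0 (bin X) (bin ds) hs; rewrite !size_map !size_tuple.
move=> /(_ erefl erefl).
rewrite (@sum_bin _ n (fun x => line (w60 t) L0 (bin X) x L0 * (tri x (bin ds) (bin hs))%:R)); last first.
  by move=> s sN; rewrite line_nonbin ?mul0r.
rewrite (@sum_bin _ n (fun D => (tri (bin X) D (bin hs))%:R * rline (w120 t) L0 D (bin ds) L0)); last first.
  by move=> s sN; rewrite (rline_nonbin _ false) ?mulr0.
move=> E; apply: (mulfI (expf_neq0 n t0)); rewrite big_distrr /=.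
under eq_bigr => x _ do rewrite mulrA -{1}(size_tuple X) -line_pieri ?size_tuple //.
rewrite E; congr (_ * _); apply: eq_bigr => D _.
by rewrite (rline_pieri _ false) ?size_tuple // mulrC.
Qed.

Local Close Scope ring_scope.

(** * Triangular puzzles are commutative *)

Definition sorted01 (j k : nat) : seq bool := nseq j false ++ nseq k true.

(** A [None] in a pattern is the label 10, whereas a result [None] means that no piece fits;
    [Some L10] is the label 10. *)
Definition up_hyp (h x : label) : option label :=
  match x, h with
  | Some false, Some false => Some L0
  | Some true, Some true => Some L1
  | Some true, None => Some L0
  | Some false, Some true => Some L10
  | None, Some false => Some L1
  | _, _ => None
  end.

Definition down_top (u y : label) : option label :=
  match u, y with
  | Some false, Some false => Some L0
  | Some false, Some true => Some L10
  | Some true, Some true => Some L1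
  | Some true, None => Some L0
  | None, Some false => Some L1
  | _, _ => None
  end.

(* Two labels of an allowed triangle determine the third. *)
Lemma strip_cons h x0 x d y0 y :
  strip h (x0 :: x) d (y0 :: y) =
  if obind (down_top^~ y0) (up_hyp h x0) is Some h' then strip h' x d y else 0.
Proof.
rewrite /= !big_label.
by case: h x0 y0 => [[]|] [[]|] [[]|]; rewrite /allowed /= ?(mul0n, mul1n, addn0, add0n).
Qed.

Lemma strip_nil h x0 x d : strip h (x0 :: x) d [::] = (x == [::]) && allowed x0 d h.
Proof. by case: x. Qed.

Lemma strip0 h d y : strip h [::] d y = 0. Proof. by case: y. Qed.

Opaque strip.

(** * Triangles with a sorted left side *)

Lemma strip_L0_true x d y : strip L0 (Some true :: x) d y = 0.
Proof. by case: y => [|y0 y]; rewrite ?strip_nil ?strip_cons //; case: x d => [|? ?] [[]|]. Qed.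

Lemma strip_L10_true k (d : bool) y :
  size y = k ->
  strip L10 (Some true :: bin (nseq k true)) (Some d) y = ~~ d && (y == bin (nseq k true)).
Proof.
elim: k y => [|k IH] [|y0 y] //=; first by rewrite strip_nil; case: d.
move=> [sy]; rewrite strip_cons; case: y0 => [[]|] //=; rewrite ?andbF //.
  by rewrite IH // eqseq_cons.
by rewrite strip_L0_true.
Qed.

Lemma strip_L10_false x (d : bool) y : strip L10 (Some false :: x) (Some d) y = 0.
Proof. by case: y => [|y0 y]; rewrite ?strip_nil ?strip_cons //; case: x d => [|? ?] []. Qed.

(** Everything is forced from the bottom: the horizontal edges carry 0 along the zeros, and 10 from
    the last zero on through the ones. An earlier 10 would meet a zero, which [strip_L10_false]
    excludes. *)
Lemma strip_L0_sorted j k (d : bool) y :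
  size y = j + k ->
  strip L0 (bin (sorted01 j.+1 k)) (Some d) y = ~~ d && (y == bin (sorted01 j k)).
Proof.
elim: j y => [|j IH] [|y0 y] //=.
- by case: k => [|//] _; rewrite strip_nil; case: d.
- case: k => [//|k] [sy]; rewrite strip_cons; case: y0 => [[]|] //=; rewrite ?andbF //.
    by rewrite strip_L10_true //= eqseq_cons.
  by rewrite strip_L0_true.
move=> [sy]; rewrite strip_cons; case: y0 => [[]|] //=; rewrite ?andbF //.
  by rewrite strip_L10_false.
by rewrite IH // eqseq_cons.
Qed.

(** Here every horizontal edge is forced to be 1, up to the top. *)
Lemma strip_L1_sorted j k (d : bool) y :
  size y = j + k ->
  strip L1 (bin (sorted01 j k.+1)) (Some d) y = d && (y == bin (sorted01 j k)).
Proof.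
elim: j y => [|j IH] y /=.
  elim: k y => [|k IH] [|y0 y] //=; first by rewrite strip_nil; case: d.
  move=> [sy]; rewrite strip_cons; case: y0 => [[]|] //=; rewrite ?andbF //.
    by rewrite IH // eqseq_cons.
  by rewrite strip_L0_true.
case: y => [//|y0 y] [sy]; rewrite strip_cons; case: y0 => [[]|] //=; rewrite ?andbF //.
by rewrite IH // eqseq_cons.
Qed.

Lemma strip_L1_false j (d : bool) y : strip L1 (bin (nseq j false)) (Some d) y = 0.
Proof.
elim: j y => [|j IH] [|y0 y] /=; rewrite ?strip0 ?strip_nil ?strip_cons //.
  by case: d IH; rewrite andbF.
by case: y0 => [[]|] /=.
Qed.

(** Each strip removes from the sorted side one symbol equal to its bottom label and copies that
    label to the NE side. *)
Lemma tri_sorted j k ds hs :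
  size ds = j + k -> size hs = j + k ->
  tri (bin (sorted01 j k)) (bin ds) (bin hs) = (ds == hs) && (count_mem true hs == k).
Proof.
elim: ds j k hs => [|d ds IH] j k [|h hs]; try by move=> <-.
  by case: j k => [|//] [|//].
move=> /= sd sh.
have dirac x (F : seq label -> nat) : size x = size ds ->
    \sum_(y : (size (bin (sorted01 j k))).-1.-tuple label) (y == x :> seq label) * F y = F x.
  rewrite size_map size_cat !size_nseq -sd /= => sx.
  rewrite (bigD1 (tcast sx (in_tuple x))) //= val_tcast eqxx mul1n big1 ?addn0 // => y.
  by rewrite -val_eqE /= val_tcast => /negbTE ->.
have sizeT (y : (size (bin (sorted01 j k))).-1.-tuple label) : size y = size ds.
  by rewrite size_tuple size_map size_cat !size_nseq -sd.
rewrite -!/(bin _) eqseq_cons; case: h.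
- case: k => [|k] in sd sh dirac sizeT *.
    rewrite /sorted01 cats0 andbF big1 // => y _; rewrite strip_L1_false //.
  transitivity (d * \sum_(y : (size (bin (sorted01 j k.+1))).-1.-tuple label)
     (y == bin (sorted01 j k) :> seq label) * tri y (bin ds) (bin hs)).
    rewrite big_distrr; apply: eq_bigr => y _ /=.
    by rewrite strip_L1_sorted ?sizeT ?mulnA ?mulnb //; lia.
  rewrite (dirac _ (fun y => tri y (bin ds) (bin hs))); last first.
    by rewrite size_map size_cat !size_nseq; lia.
  rewrite IH; [|lia|lia]; rewrite add1n eqSS.
  by case: d sd => /= _; rewrite ?mul1n.
- case: j => [|j] in sd sh dirac sizeT *.
    case: k => [//|k] in sd sh dirac sizeT *.
    rewrite big1 => [|y _]; last by rewrite strip_L0_true.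
    have /ltn_eqF -> : (false == true) + count_mem true hs < k.+1.
      by have := count_size (pred1 true) hs; rewrite /=; lia.
    by rewrite andbF.
  transitivity (~~ d * \sum_(y : (size (bin (sorted01 j.+1 k))).-1.-tuple label)
     (y == bin (sorted01 j k) :> seq label) * tri y (bin ds) (bin hs)).
    rewrite big_distrr; apply: eq_bigr => y _ /=.
    by rewrite strip_L0_sorted ?sizeT ?mulnA ?mulnb //; lia.
  rewrite (dirac _ (fun y => tri y (bin ds) (bin hs))); last first.
    by rewrite size_map size_cat !size_nseq; lia.
  rewrite IH; [|lia|lia]; rewrite add0n.
  by case: d sd => /= _; rewrite ?mul1n.
Qed.

Lemma sum_neq0 (I : finType) (F : I -> nat) : \sum_i F i != 0 -> exists i, F i != 0.
Proof.
move=> H; apply/existsP; apply: contraNT H; rewrite negb_exists => /forallP H.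
by rewrite big1 // => i _; apply/eqP; have := H i; rewrite negbK.
Qed.

(* Discrete Green's theorem on a strip whose top label is binary. *)
Lemma strip_count h x (d : bool) y :
  strip h x (Some d) y != 0 ->
  count_mem L1 x = count_mem L1 y + (h != L0) /\
  count_mem L0 x + (h == L10) = count_mem L0 y + ~~ d.
Proof.
elim: y x h => [|y0 y IH] [|x0 x] h; try by rewrite eqxx.
  rewrite strip_nil; case: x => [|//]; by case: h x0 d => [[]|] [[]|] [].
rewrite strip_cons.
case: h x0 y0 => [[]|] [[]|] [[]|] //= /IH /=; lia.
Qed.

Lemma tri_count x (ds hs : seq bool) :
  size x = size ds -> size ds = size hs -> tri x (bin ds) (bin hs) != 0 ->
  count_mem L1 x = count_mem true hs /\ count_mem L0 x = count_mem false ds.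
Proof.
elim: ds x hs => [|d ds IH] [|x0 x] [|h hs] //= [sx] [sh] /sum_neq0[y].
rewrite muln_eq0 negb_or => /andP[/strip_count[c1 c0] /IH]; rewrite size_tuple.
move=> /(_ sx sh); move: c1 c0; rewrite /=.
by case: h d x0 => [] [] [[]|] /=; lia.
Qed.

(** By [tri_count] the zeros and ones of [x] are together as many as its entries, which leaves no
    room for a 10. *)
Lemma tri_binary x (ds hs : seq bool) :
  size x = size ds -> size ds = size hs -> count_mem true ds = count_mem true hs ->
  tri x (bin ds) (bin hs) != 0 -> exists x', x = bin x'.
Proof.
move=> sx sh eqc nz; have [c1 c0] := tri_count sx sh nz.
have : count_mem L1 x + count_mem L0 x = size x.
  rewrite c1 c0 sx -eqc -(count_predC (pred1 true)); congr (_ + _).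
  by apply: eq_count => [] [].
elim: x {sx nz c1 c0} => [|a x IH] /=; first by exists [::].
have UI : count (predU (pred1 L1) (pred1 L0)) x = count_mem L1 x + count_mem L0 x.
  rewrite -count_predUI (@eq_count _ (predI (pred1 L1) (pred1 L0)) pred0).
    by rewrite count_pred0 addn0.
  by case=> [[]|].
have := count_size (predU (pred1 L1) (pred1 L0)) x; rewrite UI => le.
case: a => [a|]; last by rewrite !add0n => H; rewrite H ltnn in le.
rewrite addnACA (_ : (Some a == L1) + (Some a == L0) = 1); last by case: a.
by rewrite add1n => -[/IH[x' ->]]; exists (a :: x').
Qed.

(** * Generating all strings by Pieri operators *)

Local Open Scope ring_scope.

Notation pieriX := (@pieri {poly int} 'X).

(** The number with binary digits [s], least significant first; on strings of equal length it gives
    the colexicographic order. *)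
Fixpoint colex (s : seq bool) : nat :=
  if s is b :: s' then (b + 2 * colex s')%N else 0%N.

Lemma colex_cat s1 s2 : colex (s1 ++ s2) = (colex s1 + 2 ^ size s1 * colex s2)%N.
Proof. by elim: s1 => [|b s IH] /=; rewrite ?mul1n // IH expnS; lia. Qed.

Lemma colex_lt s : (colex s < 2 ^ size s)%N.
Proof. by elim: s => [|b s IH] //=; rewrite expnS; case: b; lia. Qed.

Lemma colex_nseq0 n : colex (nseq n false) = 0%N.
Proof. by elim: n => //= n ->. Qed.

Lemma colex_cat_lt w w' x x' :
  size w = size w' -> (colex x < colex x')%N -> (colex (w ++ x) < colex (w' ++ x'))%N.
Proof.
move=> sw lt; rewrite !colex_cat -sw.
have := colex_lt w; have : (2 ^ size w * (colex x).+1 <= 2 ^ size w * colex x')%N.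
  by rewrite leq_mul2l lt orbT.
by rewrite mulnS; lia.
Qed.

(** In the second case the displayed one is the last one that has a zero behind it. *)
Lemma unsorted_split (x : seq bool) :
  (exists j k, x = sorted01 j k) \/
  (exists w p m, x = w ++ true :: nseq p.+1 false ++ nseq m true).
Proof.
elim: x => [|b x [[j [k ->]]|[w [p [m ->]]]]]; first by left; exists 0%N, 0%N.
  case: b; last by left; exists j.+1, k.
  case: j => [|j]; first by left; exists 0%N, k.+1.
  by right; exists [::], j, k.
by right; exists (b :: w), p, m.
Qed.

Lemma pieri_true_ones m x q :
  (pieriX false (nseq m true) x)`_q != 0 -> x = nseq m true /\ q = 0%N.
Proof.
elim: m x => [|m IH] [|b x] //=; rewrite ?coef0 ?eqxx //.
  by rewrite coef1; case: q.
by case: b; rewrite ?mul1r ?mul0r ?coef0 // => /IH[-> ->].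
Qed.

Lemma pieri_carry p m x q :
  (pieriX true (nseq p false ++ nseq m.+1 true) x)`_q != 0 ->
  q = p.+1 /\ x = nseq p.+1 false ++ nseq m true.
Proof.
elim: p x q => [|p IH] [|[] x] q /=; rewrite ?coef0 ?eqxx // coefXM;
  case: q => [|q] //=; rewrite ?eqxx //.
  by move=> /pieri_true_ones[-> ->].
by move=> /IH[-> ->].
Qed.

(** The ones form a single block at the end, in which each is blocked by its predecessor: only the
    first can move, and [q] is its number of steps. *)
Lemma pieri_start p m x q :
  (pieriX false (nseq p false ++ nseq m.+1 true) x)`_q != 0 ->
  (q <= p)%N /\ x = nseq (p - q) false ++ true :: nseq q false ++ nseq m true.
Proof.
elim: p x => [|p IH] [|[] x] /=; rewrite ?coef0 ?eqxx ?mul1r ?mul0r ?coef0 //.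
- by move=> /pieri_true_ones[-> ->].
- by move=> /pieri_carry[-> ->]; rewrite subnn leqnn.
- by move=> /IH[le ->]; rewrite subSn //; split=> //; lia.
Qed.

(** The expansion is split at the end of the prefix: [q] is the degree spent behind it and [carry']
    tells whether a one crosses the boundary. If all the degree is spent behind and nothing crosses,
    the prefix is unchanged. *)
Lemma pieri_prefix carry w w' y x r :
  size w = size w' ->
  (pieriX carry (w ++ y) (w' ++ x))`_r != 0 ->
  exists q carry', [/\ (q <= r)%N, (pieriX carry' y x)`_q != 0 &
     carry' = false -> q = r -> carry = false /\ w = w'].
Proof.
elim: w w' carry r => [|a w IH] [|b w'] //= carry r.
  by move=> _ H; exists r, carry; split.
move=> [sw]; case: carry => /=.
  case: b; rewrite ?coef0 ?eqxx // coefXM; case: r => [|r] //= /IH[] // q [c [le nz H]].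
  by exists q, c; split=> //; lia.
case: a b => [] [] /=; rewrite ?mul1r ?mul0r ?coef0 ?eqxx //.
- by move=> /IH[] // q [c [le nz H]]; exists q, c; split=> // c0 qr; have [_ ->] := H c0 qr.
- by move=> /IH[] // q [c [le nz H]]; exists q, c; split=> // c0 qr; have [] := H c0 qr.
- by move=> /IH[] // q [c [le nz H]]; exists q, c; split=> // c0 qr; have [_ ->] := H c0 qr.
Qed.

(* [kappa] is [x] with the smallest nonzero row, of length [p + 1], of its
   partition removed. Among the terms of degree [p + 1] of the Pieri expansion of
   [kappa], [x] is the smallest in colexicographic order. *)
Section Generation.

Variables (w : seq bool) (p m : nat).

Let x := w ++ true :: nseq p.+1 false ++ nseq m true.
Let kappa := w ++ nseq p.+1 false ++ nseq m.+1 true.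

Lemma colex_kappa : (colex x < colex kappa)%N.
Proof.
apply: colex_cat_lt => //=.
rewrite !colex_cat !size_nseq !colex_nseq0 /=.
have : (0 < 2 ^ p)%N by rewrite expn_gt0.
by move: (2 ^ p)%N (colex _) => P c; nia.
Qed.

Lemma pieri_kappa : pieriX false kappa x = 'X ^+ p.+1.
Proof.
rewrite /kappa /x; elim: w => [|[] v IH] /=; rewrite ?mul1r //.
elim: p => [|n IH] /=; last by rewrite exprS -IH.
have -> : pieriX false (nseq m true) (nseq m true) = 1.
  by elim: m => [|k /= ->] //=; rewrite mul1r.
by rewrite mulr1.
Qed.

(** In degree [p.+1] the first one of the last block moves all the way, which gives [x], or stops
    earlier. In the latter case it stays at a more significant position, which decides the order
    whatever happens in [w]. *)
Lemma pieri_kappa_max x' :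
  size x' = size x -> (pieriX false kappa x')`_p.+1 != 0 -> x' = x \/ (colex x < colex x')%N.
Proof.
rewrite size_cat => sx; rewrite -(cat_take_drop (size w) x').
have sw : size w = size (take (size w) x') by rewrite size_takel // sx leq_addr.
move: (take _ _) (drop _ _) sw => w' y sw /(pieri_prefix sw)[q [c [le nz H]]].
(* A one leaving the last block for the prefix would spend [p.+2] steps behind the prefix, more than
   the degree allows. *)
case: c nz H => [/pieri_carry[E _]|/pieri_start[_ ->] H]; first by rewrite E in le; lia.
case: (eqVneq q p.+1) => [E|ne].
  by have [_ <-] := H erefl E; left; rewrite E subnn.
right; apply: colex_cat_lt => //.
have [r Er] : exists r, p = (q + r)%N by exists (p - q)%N; lia.
have -> : (p.+1 - q = r.+1)%N by lia.
rewrite /= !colex_cat /= !colex_cat !size_nseq !colex_nseq0 Er expnD.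
have : (0 < 2 ^ r)%N by rewrite expn_gt0.
by move: (2 ^ q)%N (2 ^ r)%N (colex _) => Q P c; nia.
Qed.

End Generation.

(** Downward induction on [colex x]: a sorted [x] is explicit, and any other [x] is reached from the
    larger string [K] by the coefficient of degree [p.+1], whose other terms are larger as well. *)
Theorem tri_comm n (x y h : n.-tuple bool) :
  tri (bin x) (bin y) (bin h) = tri (bin y) (bin x) (bin h).
Proof.
have [k] := ubnP (2 ^ n - colex x)%N; elim: k => // k IH in x y h *; rewrite ltnS => lek.
have [[j [l E]]|[w [p [m E]]]] := unsorted_split x.
  have sE : (j + l = n)%N by rewrite -(size_tuple x) E size_cat !size_nseq.
  (* The left count is explicit; in the right one a rotation by 120 degrees makes the sorted side
     the NW side again. *)
  rewrite E tri_sorted ?size_tuple //.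
  have cl : closed6 [::] (bin y) [::] (bin (sorted01 j l)) [::] (bin (rev h)).
    by split; rewrite /= !size_map ?size_rev ?size_cat ?size_nseq !size_tuple; lia.
  have R : rev (bin (rev h)) = bin h by rewrite map_rev revK.
  rewrite -{1}R -LHex_tri; last by rewrite !size_map size_rev -E !size_tuple.
    rewrite LHex_rot // LHex_rot; last by case: cl => ? ?; split; lia.
    rewrite LHex_tri ?size_map ?size_rev -?E ?size_tuple // E -map_rev.
    rewrite tri_sorted ?size_rev ?size_tuple // count_rev (inj_eq (can_inj revK)).
    by rewrite eq_sym; case: eqP => [->|].
  by rewrite !size_map -E !size_tuple.
have sk : size (w ++ nseq p.+1 false ++ nseq m.+1 true) == n.
  by rewrite -(size_tuple x) E !size_cat /= size_cat !size_nseq; apply/eqP; lia.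
have [K KE] : exists K : n.-tuple bool, tval K = w ++ nseq p.+1 false ++ nseq m.+1 true.
  by exists (Tuple sk).
have lt1 : (2 ^ n - colex K < k)%N.
  have := colex_kappa w p m; have := colex_lt K; rewrite size_tuple -E -KE; lia.
have X0 : 'X != 0 :> {poly int} by rewrite polyX_eq0.
have E1 := tri_pieri K y h X0; have E2 := tri_pieri y K h X0.
(* Moving the operator from [K] to [y] on both sides leaves two sums over [D], equal by the
   induction hypothesis for [K]. *)
have {E1 E2} : \sum_(x' : n.-tuple bool) pieriX false K x' * (tri (bin x') (bin y) (bin h))%:R =
    \sum_(x' : n.-tuple bool) pieriX false K x' * (tri (bin y) (bin x') (bin h))%:R.
  by rewrite E1 -E2; apply: eq_bigr => D _; rewrite IH.
move/(congr1 (fun q : {poly int} => q`_p.+1)).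
rewrite !coef_sum (bigD1 x) //= [in RHS](bigD1 x) //=.
(* A string other than [x] has coefficient zero or is larger than [x], so the induction hypothesis
   applies to it. *)
have -> : \sum_(i : n.-tuple bool | i != x)
      (pieriX false K i * (tri (bin i) (bin y) (bin h))%:R)`_p.+1 =
    \sum_(i : n.-tuple bool | i != x)
      (pieriX false K i * (tri (bin y) (bin i) (bin h))%:R)`_p.+1.
  apply: eq_bigr => i ix; rewrite !mulr_natr !coefMn.
  case: (eqVneq (pieriX false K i)`_p.+1 0) => [->|nz]; first by rewrite !mul0rn.
  rewrite KE in nz.
  have [|e|lt] := pieri_kappa_max _ nz; first by rewrite -E !size_tuple.
    by case/negP: ix; apply/eqP/val_inj; exact: etrans e (esym E).
  have ci : (colex i < 2 ^ n)%N by have := colex_lt i; rewrite size_tuple.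
  by rewrite IH //; apply: leq_trans lek; rewrite E; exact: ltn_sub2l (ltn_trans lt ci) lt.
move/addIr; have -> : pieriX false K x = 'X ^+ p.+1 by rewrite E KE; exact: pieri_kappa.
by rewrite !mulr_natr !coefMn coefXn eqxx => /eqP; rewrite eqr_nat => /eqP.
Qed.

Local Close Scope ring_scope.

(** * Hexagons *)

Definition same_content (s t : seq bool) : Prop :=
  size s = size t /\ count_mem true s = count_mem true t.

Lemma LHex_rot2 u v w x y z :
  closed6 u v w x y z -> LHex u v w x y z = LHex w x y z u v.
Proof.
by move=> [c1 c2]; rewrite LHex_rot // LHex_rot //; split; lia.
Qed.

Lemma LHex_rot4 u v w x y z :
  closed6 u v w x y z -> LHex u v w x y z = LHex y z u v w x.
Proof.
by move=> [c1 c2]; rewrite LHex_rot2 // LHex_rot2 //; split; lia.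
Qed.

Lemma closed_tri (x y z : seq label) :
  size x = size y -> size y = size z -> closed6 [::] x [::] y [::] z.
Proof. by split=> /=; lia. Qed.

Lemma LHex_tri_comm (x y z : seq bool) :
  size x = size y -> size y = size z ->
  LHex [::] (bin x) [::] (bin y) [::] (bin z) = LHex [::] (bin y) [::] (bin x) [::] (bin z).
Proof.
move=> sx sy; rewrite !LHex_tri ?size_map ?sx // -map_rev.
have sy' : size y == size x by rewrite sx.
have sz' : size (rev z) == size x by rewrite size_rev -sy sx.
exact: (tri_comm (in_tuple x) (Tuple sy') (Tuple sz')).
Qed.

Lemma LHex_tri_rot (x y z : seq label) :
  size x = size y -> size y = size z ->
  LHex [::] x [::] y [::] z = LHex [::] y [::] z [::] x.
Proof. by move=> sx sy; rewrite LHex_rot2 //; exact: closed_tri. Qed.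

Lemma LHex_tri_binary x (y z : seq bool) :
  size x = size y -> same_content y z ->
  LHex [::] x [::] (bin y) [::] (bin z) != 0 -> exists x', x = bin x'.
Proof.
move=> sx [sy cy]; rewrite LHex_tri ?size_map // -map_rev; apply: tri_binary => //.
  by rewrite size_rev.
by rewrite count_rev.
Qed.

(** For binary [x] this is commutativity after a rotation. Otherwise both counts vanish by
    [LHex_tri_binary], since [y] and [z] have the same content. *)
Lemma LHex_tri_comm23 x (y z : seq bool) :
  size x = size y -> same_content y z ->
  LHex [::] x [::] (bin y) [::] (bin z) = LHex [::] x [::] (bin z) [::] (bin y).
Proof.
move=> sx cyz; have [sy cy] := cyz.
have czy : same_content z y by [].
have key x' : x = bin x' ->
    LHex [::] x [::] (bin y) [::] (bin z) = LHex [::] x [::] (bin z) [::] (bin y).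
  move=> Ex; move: sx; rewrite {}Ex size_map => sx.
  rewrite LHex_tri_rot ?size_map // LHex_tri_comm -?sy //.
  by rewrite -LHex_tri_rot ?size_map // -sy.
case: (eqVneq (LHex [::] x [::] (bin y) [::] (bin z)) 0) => [E|nz]; last first.
  by have [x' Ex] := LHex_tri_binary sx cyz nz; exact: key Ex.
case: (eqVneq (LHex [::] x [::] (bin z) [::] (bin y)) 0) => [->//|nz].
by have [x' Ex] := LHex_tri_binary (etrans sx sy) czy nz; exact: key Ex.
Qed.

Lemma bin_inj : injective (map (@Some bool)).
Proof. by apply: inj_map => a b []. Qed.

(** The corner triangle that copies one side to another; the reversal appears because both are read
    clockwise. *)
Lemma LHex_tri_id j k s (z : seq bool) :
  size s = size z -> same_content (sorted01 j k) z ->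
  LHex [::] s [::] (bin (sorted01 j k)) [::] (bin z) = (s == rev (bin z)).
Proof.
move=> ss cz; have [sz ck] := cz.
have sjk : size (sorted01 j k) = j + k by rewrite size_cat !size_nseq.
have ckk : count_mem true (sorted01 j k) = k.
  by rewrite count_cat !count_nseq /= mul0n mul1n.
have key s' : s = bin s' ->
    LHex [::] s [::] (bin (sorted01 j k)) [::] (bin z) = (s == rev (bin z)).
  move=> Es; move: ss; rewrite {}Es size_map => ss.
  rewrite LHex_tri_rot ?size_map ?sz // LHex_tri ?size_map ?ss ?sz //.
  rewrite -!map_rev tri_sorted ?size_rev ?ss -?sz ?sjk //.
  rewrite (inj_eq bin_inj) [s' == _]eq_sym (can2_eq revK revK).
  by case: eqP => // Ez; rewrite -Ez -ck ckk eqxx.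
case: (eqVneq (LHex [::] s [::] (bin (sorted01 j k)) [::] (bin z)) 0) => [E|nz]; last first.
  by have [s' Es] := LHex_tri_binary (etrans ss (esym sz)) cz nz; exact: key Es.
rewrite E; case: eqP => // Es.
by rewrite -E (key (rev z)) ?Es ?eqxx // map_rev.
Qed.

(** The triangle cut off at the right corner admits exactly one string on the cut, so the sum of
    [LHex_cut] has a single term. *)
Lemma LHex_corner al be ga de1 d2 z2 ze1 tau :
  closed6 al be ga (de1 ++ d2) [::] (z2 ++ ze1) -> size d2 = size z2 ->
  size tau = size z2 ->
  (forall s, size s = size z2 -> LHex [::] s [::] d2 [::] z2 = (s == rev tau)) ->
  LHex al be ga (de1 ++ d2) [::] (z2 ++ ze1) = LHex al be ga de1 tau ze1.
Proof.
move=> cl sd st H; have [c1 c2] := cl; rewrite !size_cat /= in c1 c2.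
have := @LHex_cut al [::] be ga [::] de1 d2 [::] ze1 z2 (size z2).
rewrite /= cats0 => -> //; [|lia|lia|by right|by right].
have sr : size (rev tau) = size z2 by rewrite size_rev.
rewrite (bigD1 (tcast sr (in_tuple (rev tau)))) //= val_tcast /= revK H // eqxx muln1.
rewrite big1 ?addn0 // => s; rewrite -val_eqE /= val_tcast => /negbTE ne.
by rewrite H ?size_tuple // ne muln0.
Qed.

Section Swap.

Variables (be de ze : seq bool) (j k : nat).
Let one := sorted01 j k.
Hypotheses (sbd : size be = size de) (sbz : size be = size ze).

Lemma same_content_sizes s : same_content one s -> size s = j + k.
Proof. by case=> <- _; rewrite size_cat !size_nseq. Qed.

(** The three corners are cut off one after the other, each being rotated to the right first. *)
Lemma LHex_hexagon_tri al ga ep :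
  same_content one al -> same_content one ga -> same_content one ep ->
  LHex [::] (bin al ++ bin be ++ bin ga) [::] (bin one ++ bin de ++ bin one) [::]
       (bin ep ++ bin ze ++ bin one) =
  LHex (bin al) (bin be) (bin ga) (bin de) (bin ep) (bin ze).
Proof.
move=> ca cg ce; have [[sa sg] se] :=
  (same_content_sizes ca, same_content_sizes cg, same_content_sizes ce).
have so : size one = j + k by apply: same_content_sizes.
have cgo : same_content ga one by case: cg.
have sizes := (size_cat, size_map, sa, sg, se, so, sbd, sbz).
rewrite (catA (bin one)) (LHex_corner (tau := bin ep)) ?sizes //; first last.
- by move=> s ss; apply: LHex_tri_id; rewrite // ss !sizes.
- by split; rewrite /= ?sizes; lia.
rewrite LHex_rot4; last by split; rewrite /= ?sizes; lia.
rewrite catA (LHex_corner (tau := bin ga)) ?sizes //; first last.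
(* In this corner the sorted side is the South one, so it is first exchanged with the NE side. *)
- move=> s ss; rewrite LHex_tri_comm23 ?LHex_tri_id //; rewrite ss ?sizes //.
- by split; rewrite /= ?sizes; lia.
rewrite LHex_rot4; last by split; rewrite /= ?sizes; lia.
rewrite (LHex_corner (tau := bin al)) ?sizes //; first last.
- by move=> s ss; apply: LHex_tri_id; rewrite // ss !sizes.
- by split; rewrite /= ?sizes; lia.
by rewrite LHex_rot4 //; split; rewrite /= ?sizes; lia.
Qed.

(** With the first two sides exchanged, [ga] and [ep] meet at one corner. That corner is cut off by
    a sum over [s]; the other two are copying triangles, and the hexagon that remains no longer
    involves [ga] or [ep]. *)
Lemma LHex_tri_product al ga ep :
  same_content one al -> same_content one ga -> same_content one ep ->
  LHex [::] (bin one ++ bin de ++ bin one) [::] (bin al ++ bin be ++ bin ga) [::]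
       (bin ep ++ bin ze ++ bin one) =
  \sum_(s : (j + k).-tuple label)
     LHex (bin al) (bin be) (rev s) (bin ze) (bin one) (bin de) *
     LHex [::] s [::] (bin ga) [::] (bin ep).
Proof.
move=> ca cg ce; have [[sa sg] se] :=
  (same_content_sizes ca, same_content_sizes cg, same_content_sizes ce).
have so : size one = j + k by apply: same_content_sizes.
have sizes := (size_cat, size_map, sa, sg, se, so, sbd, sbz).
have := @LHex_cut [::] [::] (bin one ++ bin de ++ bin one) [::] [::] (bin al ++ bin be) (bin ga)
   [::] (bin ze ++ bin one) (bin ep) (j + k).
rewrite /= -catA => ->; [|by split; rewrite /= ?sizes; lia|by rewrite ?sizes; lia
  |by rewrite ?sizes; lia|by right|by right].
apply: eq_bigr => s _; congr (_ * _).
have : size (rev s) = j + k by rewrite size_rev size_tuple.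
move: (rev s) => v ss.
rewrite LHex_rot4; last by split; rewrite /= ?(sizes, ss); lia.
rewrite catA (LHex_corner (tau := bin al)) ?sizes //; first last.
- by move=> u su; apply: LHex_tri_id; rewrite // su !sizes.
- by split; rewrite /= ?(sizes, ss); lia.
rewrite LHex_rot4; last by split; rewrite /= ?(sizes, ss); lia.
rewrite (LHex_corner (tau := bin one)) ?sizes //; first last.
- by move=> u su; apply: LHex_tri_id; rewrite // su !sizes.
- by split; rewrite /= ?(sizes, ss); lia.
Qed.

Lemma LHex_swap al ga ep :
  same_content one al -> same_content one ga -> same_content one ep ->
  LHex (bin al) (bin be) (bin ga) (bin de) (bin ep) (bin ze) =
  LHex (bin al) (bin be) (bin ep) (bin de) (bin ga) (bin ze).
Proof.
move=> ca cg ce; have [[sa sg] se] :=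
  (same_content_sizes ca, same_content_sizes cg, same_content_sizes ce).
have so : size one = j + k by apply: same_content_sizes.
have sizes := (size_cat, sa, sg, se, so, sbd, sbz).
have E x y : same_content one x -> same_content one y ->
  LHex (bin al) (bin be) (bin x) (bin de) (bin y) (bin ze) =
  \sum_(s : (j + k).-tuple label)
     LHex (bin al) (bin be) (rev s) (bin ze) (bin one) (bin de) *
     LHex [::] s [::] (bin x) [::] (bin y).
  move=> cx cy; rewrite -LHex_hexagon_tri // -LHex_tri_product // -!map_cat.
  have [sx sy] := (same_content_sizes cx, same_content_sizes cy).
  by apply: LHex_tri_comm; rewrite !(sizes, sx, sy); lia.
rewrite !E //; apply: eq_bigr => s _; congr (_ * _).
apply: LHex_tri_comm23; rewrite ?size_tuple ?sg //.
by case: cg ce => [g1 g2] [e1 e2]; split; [rewrite -g1|rewrite -g2].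
Qed.

End Swap.

(** * Independent permutations of the two triples *)

Lemma same_content_sym s t : same_content s t -> same_content t s.
Proof. by case. Qed.

Lemma same_content_trans s t u : same_content s t -> same_content t u -> same_content s u.
Proof. by move=> [s1 s2] [t1 t2]; split; [rewrite s1 | rewrite s2]. Qed.

Lemma same_content_sorted s : same_content (sorted01 (count_mem false s) (count_mem true s)) s.
Proof.
split; last by rewrite count_cat !count_nseq /= mul0n mul1n.
rewrite size_cat !size_nseq -(count_predC (pred1 false)); congr (_ + _).
by apply: eq_count => [] [].
Qed.

Lemma same_content_sort s t : sort01 s = sort01 t <-> same_content s t.
Proof.
split=> [E|[ss cs]].
  have [s1 s2] := same_content_sorted s; have [t1 t2] := same_content_sorted t.
  split; first by rewrite -s1 -t1 /sorted01 -![_ ++ _]/(sort01 _) E.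
  by rewrite -s2 -t2 /sorted01 -![_ ++ _]/(sort01 _) E.
have cf : count_mem false s = count_mem false t.
  have := same_content_sorted s; have := same_content_sorted t.
  by rewrite /same_content !size_cat !size_nseq; lia.
by rewrite /sort01 cf cs.
Qed.

Lemma LHex_swap23 (a0 b0 a1 b1 a2 b2 : seq bool) :
  same_content a0 a1 -> same_content a1 a2 -> size b0 = size b1 -> size b1 = size b2 ->
  LHex (bin a0) (bin b0) (bin a1) (bin b1) (bin a2) (bin b2) =
  LHex (bin a0) (bin b0) (bin a2) (bin b1) (bin a1) (bin b2).
Proof.
move=> c01 c12 s01 s12; have c0 := same_content_sorted a0.
have c1 := same_content_trans c0 c01; have c2 := same_content_trans c1 c12.
by apply: LHex_swap c0 c1 c2 => //; rewrite s01.
Qed.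

Lemma LHex_swap13 (a0 b0 a1 b1 a2 b2 : seq bool) :
  same_content a0 a1 -> same_content a1 a2 -> size b0 = size b1 -> size b1 = size b2 ->
  LHex (bin a0) (bin b0) (bin a1) (bin b1) (bin a2) (bin b2) =
  LHex (bin a2) (bin b0) (bin a1) (bin b1) (bin a0) (bin b2).
Proof.
move=> c01 c12 s01 s12; have [[ss01 _] [ss12 _]] := (c01, c12).
have c20 := same_content_sym (same_content_trans c01 c12).
rewrite LHex_rot2; last by split; rewrite !size_map; lia.
rewrite LHex_swap23 //; last by lia.
by rewrite LHex_rot4 //; split; rewrite !size_map; lia.
Qed.

(** The exchanges of positions 2, 3 and of positions 1, 3 generate all permutations. *)
Lemma hex3_permA (A : 'I_3 -> seq bool) (b0 b1 b2 : seq bool) (f : {perm 'I_3}) :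
  (forall i j, same_content (A i) (A j)) -> size b0 = size b1 -> size b1 = size b2 ->
  LHex (bin (A i0)) (bin b0) (bin (A i1)) (bin b1) (bin (A i2)) (bin b2) =
  LHex (bin (A (f i0))) (bin b0) (bin (A (f i1))) (bin b1) (bin (A (f i2))) (bin b2).
Proof.
move=> cA s01 s12.
have I3 (i : 'I_3) : [\/ i = i0, i = i1 | i = i2].
  by case: i => [[|[|[|i]]] Hi] //; [constructor 1|constructor 2|constructor 3]; apply: val_inj.
have d01 : f i0 != f i1 by rewrite (inj_eq (@perm_inj _ f)).
have d02 : f i0 != f i2 by rewrite (inj_eq (@perm_inj _ f)).
have d12 : f i1 != f i2 by rewrite (inj_eq (@perm_inj _ f)).
have S23 x y z := @LHex_swap23 (A x) b0 (A y) b1 (A z) b2 (cA x y) (cA y z) s01 s12.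
have S13 x y z := @LHex_swap13 (A x) b0 (A y) b1 (A z) b2 (cA x y) (cA y z) s01 s12.
move: d01 d02 d12.
case: (I3 (f i0)) => ->; case: (I3 (f i1)) => ->; case: (I3 (f i2)) => -> //= _ _ _.
- by rewrite (S13 i0 i1 i2) (S23 i2 i1 i0); exact: S13.
- by rewrite (S23 i0 i1 i2); exact: S13.
- by rewrite (S13 i0 i1 i2); exact: S23.
Qed.

(** A rotation by 60 degrees puts the strings of [B] in the places of those of [A], so the previous
    lemma serves both triples. *)
Lemma hex3_perm (A B : 'I_3 -> seq bool) (f g : {perm 'I_3}) :
  (forall i j, same_content (A i) (A j)) -> (forall i j, same_content (B i) (B j)) ->
  LHex (bin (A i0)) (bin (B i0)) (bin (A i1)) (bin (B i1)) (bin (A i2)) (bin (B i2)) =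
  LHex (bin (A (f i0))) (bin (B (g i0))) (bin (A (f i1))) (bin (B (g i1)))
       (bin (A (f i2))) (bin (B (g i2))).
Proof.
move=> cA cB; have sA i j : size (A i) = size (A j) by case: (cA i j).
have sB i j : size (B i) = size (B j) by case: (cB i j).
rewrite (hex3_permA f) //.
have rot x y z u v w : LHex (bin (A x)) (bin (B y)) (bin (A z)) (bin (B u)) (bin (A v)) (bin (B w))
    = LHex (bin (B y)) (bin (A z)) (bin (B u)) (bin (A v)) (bin (B w)) (bin (A x)).
  have [[[e1 e2] e3] e4] := (sA x v, sA x z, sB y u, sB u w).
  by apply: LHex_rot; split; rewrite !size_map; lia.
by rewrite !rot (hex3_permA g).
Qed.

Theorem theorem9
  (a0 a1 b0 b1 c0 c1 d0 d1 e0 e1 z0 z1 : nat)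
  (hbc0 : b0 + c0 = e0 + z0) (hbc1 : b1 + c1 = e1 + z1)
  (hab0 : a0 + b0 = d0 + e0) (hab1 : a1 + b1 = d1 + e1)
  (hcd0 : c0 + d0 = z0 + a0) (hcd1 : c1 + d1 = z1 + a1)
  (alpha beta gamma delta epsilon zeta : seq bool)
  (halpha : alpha \in binstr (a0 + a1) a1)
  (hbeta : beta \in binstr (b0 + b1) b1)
  (hgamma : gamma \in binstr (c0 + c1) c1)
  (hdelta : delta \in binstr (d0 + d1) d1)
  (hepsilon : epsilon \in binstr (e0 + e1) e1)
  (hzeta : zeta \in binstr (z0 + z1) z1)
  (hsort1 : sort01 alpha = sort01 gamma)
  (hsort2 : sort01 gamma = sort01 epsilon) :
  (sort01 beta = sort01 delta /\ sort01 delta = sort01 zeta) /\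
  forall f g : {perm 'I_3},
    let A := triple alpha gamma epsilon in
    let B := triple beta delta zeta in
    Hex alpha beta gamma delta epsilon zeta =
    Hex (A (f i0)) (B (g i0)) (A (f i1)) (B (g i1)) (A (f i2)) (B (g i2)).
Proof.
move: hsort1 hsort2 => /same_content_sort cag /same_content_sort cge.
(* The closing equations for zeros and for ones carry equality of contents over to the other
   triple. *)
have [cbd cdz] : same_content beta delta /\ same_content delta zeta.
  move: halpha hbeta hgamma hdelta hepsilon hzeta cag cge.
  rewrite /same_content !inE => /andP[/eqP -> /eqP ->] /andP[/eqP -> /eqP ->].
  move=> /andP[/eqP -> /eqP ->] /andP[/eqP -> /eqP ->] /andP[/eqP -> /eqP ->].
  by move=> /andP[/eqP -> /eqP ->] [? ?] [? ?]; lia.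
split=> [|f g A B]; first by split; apply/same_content_sort.
have triple_content u v w : same_content u v -> same_content v w ->
    forall i j, same_content (triple u v w i) (triple u v w j).
  move=> uv vw; have uw := same_content_trans uv vw.
  by case=> [[|[|[|i]]] Hi] [[|[|[|j]]] Hj] //; rewrite /triple /=; try exact: same_content_sym.
by rewrite !Hex_LHex; apply: (@hex3_perm A B f g); exact: triple_content.
Qed.
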